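(* There exist constants $C_n>0$ ($n\ge 1$) with $\sup_n C_n<\infty$ and $C_n\to \frac{2\pi}{\sqrt{e}}$ as $n\to\infty$ such that for every $N> n$ and every closed $n$-dimensional submanifold $M^n\subset\mathbb{R}^N$, $$W^{l^\infty}_{n-1}(M^n)\leq C_n\,\sqrt{n}\,\mathrm{vol}(M^n)^{\frac{1}{n}}.$$ In particular $W^{l^\infty}_{n-1}(M^n)\leq C\sqrt{n}\,\mathrm{vol}(M^n)^{1/n}$ for an absolute constant $C$ independent of $n$ and $N$.
   Context: For $x\in\mathbb{R}^N$, $\Vert x\Vert_{l^\infty}=\max_i |x_i|$. For a closed manifold $M^n\subset\mathbb{R}^N$, its $l^\infty$-width $W^{l^\infty}_{n-1}(M^n)$ is the infimum, over all $(n-1)$-dimensional polyhedra $K^{n-1}\subset\mathbb{R}^N$ and all continuous maps $\phi:M^n\to K^{n-1}$, of $\sup_{x\in M^n}\Vert x-\phi(x)\Vert_{l^\infty}$. Here $\mathrm{vol}(M^n)$ is the $n$-dimensional volume of $M^n$ induced by the Euclidean metric of $\mathbb{R}^N$. *)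

(* Defs.v *)
From HB Require Import structures.
From mathcomp Require Import all_boot all_order all_algebra.
From mathcomp Require Import all_classical all_reals all_analysis.
Set Implicit Arguments. Unset Strict Implicit. Unset Printing Implicit Defensive.
Import Order.TTheory GRing.Theory Num.Theory.
Import numFieldNormedType.Exports.
Local Open Scope classical_set_scope.
Local Open Scope ring_scope.

Section Defs.
Variable R : realType.

Definition eucl_norm (N : nat) (x : 'rV[R]_N) : R :=
  Num.sqrt (\sum_(i < N) x 0 i ^+ 2).

Definition linf_norm (N : nat) (x : 'rV[R]_N) : R :=
  \big[Num.max/0]_(i < N) `|x 0 i|.

(* Euclidean diameter (diameter of the empty set taken to be 0) *)
Definition eucl_diam (N : nat) (E : set 'rV[R]_N) : \bar R :=
  ereal_sup ([set 0%E] `|` [set (eucl_norm (x - y))%:E | x in E & y in E]).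

(* volume of the unit ball of R^n : pi^(n/2) / Gamma(n/2 + 1) *)
Fixpoint unit_ball_vol (n : nat) : R :=
  match n with
  | 0%N => 1
  | 1%N => 2
  | (m.+2)%N => 2 * pi / (m.+2)%:R * unit_ball_vol m
  end.

Definition hausdorff_pre (n N : nat) (delta : R) (A : set 'rV[R]_N) : \bar R :=
  ereal_inf [set (\sum_(0 <= i <oo)
                   ((unit_ball_vol n * (fine (eucl_diam (E i)) / 2) ^+ n)%:E))%E
            | E in [set E : nat -> set 'rV[R]_N |
                    A `<=` \bigcup_i E i /\ forall i, (eucl_diam (E i) <= delta%:E)%E]].

Definition hausdorff_measure (n N : nat) (A : set 'rV[R]_N) : \bar R :=
  ereal_sup [set hausdorff_pre n delta A | delta in [set d : R | 0 < d]].

Fixpoint Ck_on (n N : nat) (k : nat) (V : set 'rV[R]_n) (g : 'rV[R]_n -> 'rV[R]_N)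
  : Prop :=
  match k with
  | 0%N => forall x, V x -> {for x, continuous g}
  | k'.+1 => (forall x, V x -> differentiable g x) /\
             forall i : 'I_n, Ck_on k' V (fun x => 'D_(delta_mx 0 i) g x)
  end.

Definition smooth_on (n N : nat) (V : set 'rV[R]_n) (g : 'rV[R]_n -> 'rV[R]_N) :=
  forall k, Ck_on k V g.

Definition coord_proj (n N : nat) (f : 'I_n -> 'I_N) (x : 'rV[R]_N) : 'rV[R]_n :=
  \row_(i < n) x 0 (f i).

(* closed (compact, boundaryless) smooth n-dimensional embedded submanifold of R^N:
   compact, and locally the graph of a smooth map over an n-dim coordinate plane *)
Definition closed_submanifold (n N : nat) (M : set 'rV[R]_N) : Prop :=
  compact M /\
  forall p, M p ->
    exists (f : 'I_n -> 'I_N) (U : set 'rV[R]_N) (V : set 'rV[R]_n)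
           (g : 'rV[R]_n -> 'rV[R]_N),
      [/\ injective f, open U /\ U p, open V,
          smooth_on V g /\ (forall u, V u -> coord_proj f (g u) = u) &
          M `&` U = U `&` (g @` V)].

Definition conv_hull (k N : nat) (v : 'I_k -> 'rV[R]_N) : set 'rV[R]_N :=
  [set x | exists w : 'I_k -> R,
     [/\ (forall i, 0 <= w i), \sum_(i < k) w i = 1 & x = \sum_(i < k) w i *: v i]].

(* a (finite) polyhedron of dimension <= d in R^N: finite union of simplices
   each spanned by d+1 (not necessarily distinct) points *)
Definition polyhedron (d N : nat) (K : set 'rV[R]_N) : Prop :=
  exists (m : nat) (v : 'I_m -> 'I_d.+1 -> 'rV[R]_N),
    K = \bigcup_(j in [set j : 'I_m | True]) conv_hull (v j).

Definition linf_width (n N : nat) (M : set 'rV[R]_N) : \bar R :=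
  ereal_inf [set ereal_sup [set (linf_norm (x - phi x))%:E | x in M]
            | phi in [set phi : 'rV[R]_N -> 'rV[R]_N |
                      exists K, polyhedron n.-1 K /\
                        {within M, continuous phi} /\ phi @` M `<=` K]].

End Defs.

(* Main.v *)
(**
For [s > 0] the [2 ^ N] products of functions [cos^2 (pi x_i / s)] and
[sin^2 (pi x_i / s)] form a partition of unity; each of them is positive exactly
on a union of disjoint open cubes of side [s].  As in the spherical cubes of
Kindler, O'Donnell, Rao and Wigderson, a random foam arises by drawing one
after the other random superlevel sets of random members of the partition, each
filling only what is not yet filled.  The members [f] satisfy
[sum_f |grad f| <= 2 pi sqrt k / s] along every [k]-plane, whatever [N] is, so
such a foam meets a [k]-dimensional set in expected [(k-1)]-volume at most
[2 pi sqrt k / s] times the [k]-volume.  Intersecting with [n] independent foams,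
the expected number of points of [M] on all of them is at most
[(2 pi / s)^n sqrt (n!)] times the volume.  When this is less than one, some
[n] foams have no common point on [M]: their cells cover [M], and sending a
point to a weighted mean of the centres of the at most [n] cubes that contain
it gives a map into an [(n-1)]-dimensional polyhedron which moves no coordinate
by more than [s / 2].

The volume only enters through covers of [M] by small sets.  A set of diameter
[d] is replaced by a ball of radius [d], which costs a factor [2 ^ n]; the
displacement [s / 2] instead of [s] makes up for it.  Balls are weighted
by Gaussians, so that slicing a ball by a foam amounts to a one-dimensional
Gaussian integral, and expectations are replaced by a greedy choice.
*)
Require Import Defs.
From HB Require Import structures.
From mathcomp Require Import all_boot all_order all_algebra.
From mathcomp Require Import all_classical all_reals all_analysis.
From mathcomp Require Import measurable_realfun.
From mathcomp Require Import ring lra.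
Import Order.TTheory GRing.Theory Num.Theory.
Import numFieldNormedType.Exports.
Local Open Scope classical_set_scope.
Local Open Scope ring_scope.

Set Implicit Arguments.
Unset Strict Implicit.
Unset Printing Implicit Defensive.

(** * Euclidean linear algebra *)

Section Euclid.
Variable R : realType.
Implicit Types n m k : nat.

Definition dotv n (x y : 'rV[R]_n) : R := (x *m y^T) 0 0.

Lemma mul_row_tr n (x y : 'rV[R]_n) : x *m y^T = (dotv x y)%:M.
Proof. exact: mx11_scalar. Qed.

Lemma dotvE n (x y : 'rV[R]_n) : dotv x y = \sum_i x 0 i * y 0 i.
Proof. by rewrite /dotv mxE; apply: eq_bigr => i _; rewrite mxE. Qed.

Lemma dotvC n (x y : 'rV[R]_n) : dotv x y = dotv y x.
Proof. by rewrite !dotvE; apply: eq_bigr => i _; rewrite mulrC. Qed.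

Lemma dotvDl n (x y z : 'rV[R]_n) : dotv (x + y) z = dotv x z + dotv y z.
Proof. by rewrite /dotv mulmxDl mxE. Qed.

Lemma dotvDr n (x y z : 'rV[R]_n) : dotv z (x + y) = dotv z x + dotv z y.
Proof. by rewrite dotvC dotvDl !(dotvC z). Qed.

Lemma dotvZl n a (x y : 'rV[R]_n) : dotv (a *: x) y = a * dotv x y.
Proof. by rewrite /dotv -scalemxAl mxE. Qed.

Lemma dotvZr n a (x y : 'rV[R]_n) : dotv x (a *: y) = a * dotv x y.
Proof. by rewrite dotvC dotvZl dotvC. Qed.

Lemma dotvNl n (x y : 'rV[R]_n) : dotv (- x) y = - dotv x y.
Proof. by rewrite -scaleN1r dotvZl mulN1r. Qed.

Lemma dotvNr n (x y : 'rV[R]_n) : dotv x (- y) = - dotv x y.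
Proof. by rewrite dotvC dotvNl dotvC. Qed.

Lemma dotvBl n (x y z : 'rV[R]_n) : dotv (x - y) z = dotv x z - dotv y z.
Proof. by rewrite dotvDl dotvNl. Qed.

Lemma dotvBr n (x y z : 'rV[R]_n) : dotv z (x - y) = dotv z x - dotv z y.
Proof. by rewrite dotvDr dotvNr. Qed.

Lemma dotv_mulmx n m (a : 'rV[R]_m) (E : 'M[R]_(m, n)) y :
  dotv (a *m E) y = dotv a (y *m E^T).
Proof. by rewrite /dotv trmx_mul trmxK mulmxA. Qed.

Lemma dotvv_ge0 n (x : 'rV[R]_n) : 0 <= dotv x x.
Proof. by rewrite dotvE; apply: sumr_ge0 => i _; rewrite -expr2 sqr_ge0. Qed.

Lemma enorm_ge0 n (x : 'rV[R]_n) : 0 <= eucl_norm x.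
Proof. exact: sqrtr_ge0. Qed.

Lemma enorm_sqr n (x : 'rV[R]_n) : eucl_norm x ^+ 2 = dotv x x.
Proof.
have e : dotv x x = \sum_(i < n) x 0 i ^+ 2.
  by rewrite dotvE; apply: eq_bigr => i _; rewrite expr2.
by rewrite /eucl_norm -e sqr_sqrtr // dotvv_ge0.
Qed.

Lemma enorm_le n (x : 'rV[R]_n) m (y : 'rV[R]_m) :
  (eucl_norm x <= eucl_norm y) = (dotv x x <= dotv y y).
Proof. by rewrite -ler_sqr ?nnegrE ?enorm_ge0 // !enorm_sqr. Qed.

Lemma enorm_leP n (x : 'rV[R]_n) a :
  0 <= a -> (eucl_norm x <= a) = (dotv x x <= a ^+ 2).
Proof. by move=> a0; rewrite -ler_sqr ?nnegrE ?enorm_ge0 // !enorm_sqr. Qed.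

Lemma enorm0 n : eucl_norm (0 : 'rV[R]_n) = 0.
Proof. by rewrite /eucl_norm big1 ?sqrtr0 // => i _; rewrite mxE expr0n. Qed.

Lemma enorm_eq0 n (x : 'rV[R]_n) : (eucl_norm x == 0) = (x == 0).
Proof.
apply/idP/eqP => [/eqP h|->]; last by rewrite enorm0.
have := enorm_sqr x; rewrite h expr0n /= dotvE => /esym/eqP.
rewrite psumr_eq0; last by move=> i _; rewrite -expr2 sqr_ge0.
move=> /allP hx; apply/rowP => i; rewrite mxE.
by have := hx i (mem_index_enum i); rewrite -expr2 sqrf_eq0 => /eqP.
Qed.

Lemma dotvv_eq0 n (x : 'rV[R]_n) : (dotv x x == 0) = (x == 0).
Proof. by rewrite -enorm_sqr sqrf_eq0 enorm_eq0. Qed.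

Lemma dotv_CS n (x y : 'rV[R]_n) :
  `|dotv x y| <= eucl_norm x * eucl_norm y.
Proof.
have xx := dotvv_ge0 x; have yy := dotvv_ge0 y.
rewrite -ler_sqr ?nnegrE ?mulr_ge0 ?enorm_ge0 // exprMn !enorm_sqr real_normK ?num_real //.
case: (eqVneq y 0) => [->|y0].
  by rewrite -(scale0r 0) !dotvZr !mul0r mulr0 expr0n.
have y1 : 0 < dotv y y by rewrite lt_def dotvv_eq0 y0.
have := dotvv_ge0 (dotv y y *: x - dotv x y *: y).
rewrite !(dotvBl, dotvBr, dotvZl, dotvZr) (dotvC y x) => h.
rewrite -subr_ge0 -(pmulr_rge0 _ y1); lra.
Qed.

Lemma enormZ n a (x : 'rV[R]_n) : eucl_norm (a *: x) = `|a| * eucl_norm x.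
Proof.
apply/eqP; rewrite -(@eqrXn2 _ 2) ?mulr_ge0 ?enorm_ge0 // exprMn !enorm_sqr.
by rewrite real_normK ?num_real // dotvZl dotvZr mulrA expr2.
Qed.

Lemma enormN n (x : 'rV[R]_n) : eucl_norm (- x) = eucl_norm x.
Proof. by rewrite -scaleN1r enormZ normrN1 mul1r. Qed.

Lemma enormBC n (x y : 'rV[R]_n) : eucl_norm (x - y) = eucl_norm (y - x).
Proof. by rewrite -enormN opprB. Qed.

Lemma enormD n (x y : 'rV[R]_n) :
  eucl_norm (x + y) <= eucl_norm x + eucl_norm y.
Proof.
rewrite enorm_leP ?addr_ge0 ?enorm_ge0 // !(dotvDl, dotvDr) (dotvC y x) sqrrD !enorm_sqr.
have := dotv_CS x y; have := ler_norm (dotv x y); lra.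
Qed.

Lemma enorm_trans n (z x y : 'rV[R]_n) :
  eucl_norm (x - y) <= eucl_norm (x - z) + eucl_norm (z - y).
Proof. by rewrite -[x - y](subrKA z) enormD. Qed.

Lemma coord_le_enorm n (x : 'rV[R]_n) i : `|x 0 i| <= eucl_norm x.
Proof.
rewrite -ler_sqr ?nnegrE ?enorm_ge0 // enorm_sqr real_normK ?num_real //.
rewrite dotvE (bigD1 i) //= -expr2 lerDl.
by apply: sumr_ge0 => j _; rewrite -expr2 sqr_ge0.
Qed.

Lemma enorm_le_sum n (x : 'rV[R]_n) : eucl_norm x <= \sum_i `|x 0 i|.
Proof.
have s0 (P : pred 'I_n) : 0 <= \sum_(i | P i) `|x 0 i| by exact: sumr_ge0.
rewrite enorm_leP // dotvE expr2 mulr_suml; apply: ler_sum => i _.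
rewrite -expr2 -real_normK ?num_real // expr2 ler_wpM2l //.
by rewrite (bigD1 i) //= lerDl.
Qed.

Lemma enorm_delta n (i : 'I_n) : eucl_norm (delta_mx 0 i : 'rV[R]_n) = 1.
Proof.
apply/eqP; rewrite -(@eqrXn2 _ 2) ?enorm_ge0 // enorm_sqr dotvE (bigD1 i) //= big1.
  by rewrite !mxE !eqxx /= mulr1 addr0 expr1n.
by move=> j ji; rewrite !mxE /= (negPf ji) mul0r.
Qed.

(** Approximating planes are given by contractions instead of isometric embeddings: zero rows are
    then allowed, and no rank has to be tracked. *)
Definition contractive m n (E : 'M[R]_(m, n)) :=
  forall a : 'rV_m, eucl_norm (a *m E) <= eucl_norm a.

Lemma contraction_row m n (E : 'M[R]_(m, n)) i :
  contractive E -> eucl_norm (row i E) <= 1.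
Proof. by move=> hE; rewrite rowE (le_trans (hE _)) // enorm_delta. Qed.

Lemma partial_isometry_tr m n (E : 'M[R]_(m, n)) :
  E *m E^T *m E = E -> E^T *m E *m E^T = E^T.
Proof. by move=> hE; apply: trmx_inj; rewrite !trmx_mul !trmxK mulmxA. Qed.

(* Gram-Schmidt with dependent vectors replaced by zero rows: [E] is a partial
   isometry and [E^T *m E] the orthogonal projection onto a space containing
   the rows of [J]. *)
Lemma gram_schmidt m n (J : 'M[R]_(m, n)) :
  exists E : 'M[R]_(m, n), E *m E^T *m E = E /\ J *m E^T *m E = J.
Proof.
elim: m J => [|m IH]; last rewrite -[m.+1]/(1 + m)%N; move=> J.
  by exists 0; split; [rewrite !mul0mx|rewrite [J]flatmx0 !mul0mx].
rewrite -[J]vsubmxK; set j := usubmx _; set J' := dsubmx _.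
have [E' [E1 E2]] := IH J'.
pose r : 'rV_n := j - j *m E'^T *m E'.
pose e : 'rV_n := (eucl_norm r)^-1 *: r.
have rE : r *m E'^T = 0.
  by rewrite mulmxBl -!mulmxA [E'^T *m _]mulmxA partial_isometry_tr // subrr.
have eE : e *m E'^T = 0 by rewrite -scalemxAl rE scaler0.
have Ee : E' *m e^T = 0 by rewrite -[LHS]trmxK trmx_mul trmxK eE trmx0.
have rr : r *m r^T = (eucl_norm r ^+ 2)%:M.
  by rewrite mul_row_tr enorm_sqr.
have [r0|r0] := eqVneq r 0.
  have e0 : e = 0 by rewrite /e r0 scaler0.
  exists (col_mx 0 E'); rewrite tr_col_mx !trmx0 -!mulmxA mul_row_col mul0mx add0r.
  rewrite !mul_col_mx mul0mx !mulmxA E1 E2; split => //.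
  by congr col_mx; apply/esym/subr0_eq.
have n0 : eucl_norm r != 0 by rewrite enorm_eq0.
have eT : e^T = (eucl_norm r)^-1 *: r^T by rewrite linearZ.
exists (col_mx e E'); rewrite tr_col_mx -!mulmxA mul_row_col !mul_col_mx !mulmxDr.
have -> : e *m (e^T *m e) = e.
  rewrite mulmxA eT /e -!scalemxAl -!scalemxAr -!scalemxAl rr mul_scalar_mx.
  by rewrite !scalerA; congr (_ *: _); field.
rewrite !mulmxA eE Ee E1 E2 !mul0mx add0r addr0; split => //.
have Je : J' *m e^T = 0 by rewrite -E2 -mulmxA Ee mulmx0.
rewrite Je mul0mx add0r; congr col_mx.
have -> : j *m e^T = r *m e^T.
  have {1}-> : j = r + j *m E'^T *m E' by rewrite /r subrK.
  by rewrite mulmxDl -[X in _ + X]mulmxA Ee mulmx0 addr0.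
rewrite eT /e -!scalemxAr -scalemxAl rr mul_scalar_mx !scalerA.
rewrite [X in X *: _](_ : _ = 1); last by field.
by rewrite scale1r /r subrK.
Qed.

Section PartialIsometry.
Variables (m n : nat) (E : 'M[R]_(m, n)).
Hypothesis hE : E *m E^T *m E = E.

Lemma partial_isometry_dotv a : dotv (a *m E) (a *m E) = dotv (a *m E *m E^T) a.
Proof. by rewrite dotv_mulmx dotvC. Qed.

(** Expanding the square of the norm of [a - a *m E *m E^T], where [E *m E^T] acts as an orthogonal
    projection on coefficients. *)
Lemma partial_isometry_contraction : contractive E.
Proof.
move=> a; rewrite enorm_le.
have h : dotv (a *m E *m E^T) (a *m E *m E^T) = dotv (a *m E) (a *m E).
  by rewrite dotv_mulmx trmxK -!mulmxA [E *m (E^T *m _)]mulmxA hE.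
have := dotvv_ge0 (a - a *m E *m E^T).
rewrite !(dotvBl, dotvBr) h (dotvC a) -partial_isometry_dotv; lra.
Qed.

End PartialIsometry.

(** Pythagoras: the error of the projection [p] of [z] is orthogonal to [p - w]. *)
Lemma partial_isometry_proj m n (E : 'M[R]_(m, n)) z w :
  E *m E^T *m E = E -> w *m E^T *m E = w ->
  eucl_norm (z - z *m E^T *m E) <= eucl_norm (z - w).
Proof.
move=> hE hw; rewrite enorm_le.
set p := z *m E^T *m E.
have -> : z - w = (z - p) + (p - w) by rewrite addrA subrK.
have h : dotv (z - p) (p - w) = 0.
  have -> : p - w = (z - w) *m E^T *m E by rewrite !mulmxBl hw.
  rewrite dotvC dotv_mulmx.
  have -> : (z - p) *m E^T = 0.
    by rewrite mulmxBl /p -!mulmxA [E^T *m _]mulmxA partial_isometry_tr // subrr.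
  by rewrite /dotv trmx0 mulmx0 mxE.
move: (z - p) (p - w) h => q r h; rewrite dotvDl !dotvDr h (dotvC r q) h.
by have := dotvv_ge0 r; lra.
Qed.

(* Householder reflection exchanging the unit vector [u] and [delta_mx 0 i]. *)
Lemma householder n (u : 'rV[R]_n) i : dotv u u = 1 ->
  exists O : 'M[R]_n, [/\ O^T = O, O *m O = 1%:M & row i O = u].
Proof.
move=> u1; pose e : 'rV[R]_n := delta_mx 0 i; pose w := u - e.
have ee : dotv e e = 1 by rewrite -enorm_sqr enorm_delta expr1n.
have [w0|w0] := eqVneq w 0.
  exists 1%:M; split; rewrite ?trmx1 ?mul1mx //.
  by rewrite rowE mulmx1 -/e; apply/esym/subr0_eq.
have ww : dotv w w != 0 by rewrite dotvv_eq0.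
have wwE := mul_row_tr w w.
exists (1%:M - (2 / dotv w w) *: (w^T *m w)); split.
- by rewrite linearB /= trmx1 linearZ /= trmx_mul trmxK.
- have PP : w^T *m w *m (w^T *m w) = dotv w w *: (w^T *m w).
    by rewrite -mulmxA [w *m _]mulmxA wwE mul_scalar_mx -scalemxAr.
  set c := 2 / _; set P := w^T *m w.
  rewrite mulmxBr mulmx1 mulmxBl mul1mx -scalemxAl -scalemxAr PP !scalerA.
  have -> : c * c * dotv w w = c + c by rewrite /c; field.
  by rewrite scalerDl opprB addrK subrK.
- rewrite rowE mulmxBr mulmx1 -/e -scalemxAr mulmxA.
  rewrite mul_row_tr mul_scalar_mx scalerA.
  have -> : 2 / dotv w w * dotv e w = -1.
    have h : dotv w w = - 2 * dotv e w.
      rewrite !(dotvBl, dotvBr) u1 ee (dotvC u e); ring.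
    have h2 : dotv e w != 0 by move: ww; rewrite h mulf_eq0 negb_or => /andP[].
    by rewrite h; field.
  by rewrite scaleN1r opprK addrC subrK.
Qed.

(** A reflection of the coefficient space carries the direction of [c] to the first coordinate. With
    [c] a gradient pulled back to the plane, fixing a level fixes that coordinate and leaves a
    contraction in one dimension less. *)
Lemma contraction_split k n (E : 'M[R]_(k.+1, n)) (c : 'rV[R]_k.+1) :
  contractive E -> c != 0 ->
  exists (e : 'rV[R]_n) (E' : 'M[R]_(k, n)),
    [/\ eucl_norm e <= 1, contractive E' &
     forall a, exists a', a *m E = (dotv a c / eucl_norm c) *: e + a' *m E' /\
       dotv a a = (dotv a c / eucl_norm c) ^+ 2 + dotv a' a'].
Proof.
move=> hE c0; have n0 : eucl_norm c != 0 by rewrite enorm_eq0.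
pose u := (eucl_norm c)^-1 *: c.
have u1 : dotv u u = 1.
  by rewrite dotvZl dotvZr -enorm_sqr; field.
have [H [Otr Osq Orow]] := householder 0 u1.
have isoO (a : 'rV_k.+1) : dotv (a *m H) (a *m H) = dotv a a.
  by rewrite dotv_mulmx Otr -mulmxA Osq mulmx1.
have contrOE : contractive (H *m E).
  move=> a; rewrite mulmxA; apply: le_trans (hE _) _.
  by rewrite enorm_le isoO.
have defOE : H *m E = col_mx (@usubmx _ 1 k _ (H *m E)) (@dsubmx _ 1 k _ (H *m E)).
  by rewrite (@vsubmxK _ 1 k).
set e := usubmx _ in defOE; set E' := dsubmx _ in defOE.
exists e, E'; split.
- have := contraction_row 0 contrOE; rewrite (_ : row 0 _ = e) //.
  apply/rowP => j; rewrite !mxE; apply: eq_bigr => l _.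
  by congr (H _ _ * _); apply/val_inj.
- move=> a; have := contrOE (@row_mx _ 1 1 k 0 a).
  rewrite defOE (@mul_row_col _ 1 1 k) mul0mx add0r => /le_trans; apply.
  rewrite enorm_le /dotv (@tr_row_mx _ 1 1 k) (@mul_row_col _ 1 1 k) mul0mx add0r //.
- move=> a; pose b : 'rV_(1 + k) := a *m H.
  have b1 : lsubmx b = (dotv a c / eucl_norm c)%:M.
    have -> : dotv a c / eucl_norm c = dotv a u by rewrite dotvZr mulrC.
    apply/matrixP => p q; rewrite !ord1 !mxE eqxx mulr1n dotvE; apply: eq_bigr => l _.
    rewrite -Orow !mxE -[in LHS]Otr mxE; congr (_ * H _ _); exact: val_inj.
  exists (rsubmx b); split.
    have -> : a *m E = b *m (H *m E) by rewrite mulmxA -[b *m H]mulmxA Osq mulmx1.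
    by rewrite defOE -{1}[b](hsubmxK) mul_row_col b1 mul_scalar_mx.
  rewrite -isoO -/b.
  have -> : dotv b b = dotv (row_mx (lsubmx b) (rsubmx b)) (row_mx (lsubmx b) (rsubmx b)).
    by rewrite hsubmxK.
  rewrite {1}/dotv tr_row_mx mul_row_col mxE b1 tr_scalar_mx -scalar_mxM.
  by rewrite [X in X + _]mxE eqxx mulr1n expr2.
Qed.

End Euclid.

(** * A trigonometric partition of unity *)

Section TrigPartition.
Variable R : realType.
Implicit Types (b : bool) (t u v h : R).

Definition trig b t : R := if b then sin t else cos t.
Definition dtrig b t : R := if b then cos t else - sin t.

Lemma trig_le1 b t : `|trig b t| <= 1.
Proof. by case: b; [exact: sin_max|exact: cos_max]. Qed.

Lemma dtrig_le1 b t : `|dtrig b t| <= 1.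
Proof. by case: b; rewrite /dtrig ?normrN; [exact: cos_max|exact: sin_max]. Qed.

Lemma is_derive_trig b t : is_derive t 1 (trig b) (dtrig b t).
Proof. case: b; [exact: is_derive_sin|exact: is_derive_cos]. Qed.

Lemma is_derive_dtrig b t : is_derive t 1 (dtrig b) (- trig b t).
Proof.
case: b; first exact: is_derive_cos.
by rewrite /dtrig /trig; exact: is_deriveN.
Qed.

Lemma derive_lipschitz (f df : R -> R) (M : R) :
  (forall t, is_derive t 1 f (df t)) -> (forall t, `|df t| <= M) ->
  forall u v, `|f u - f v| <= M * `|u - v|.
Proof.
move=> fd dM u v; wlog uv : u v / v <= u => [H|].
  by have [/H//|/ltW /H] := leP v u; rewrite distrC (distrC v u).
have [|c _ ->] := @MVT_segment R f df v u uv (fun x _ => fd x).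
  apply: continuous_subspaceT => x; apply: differentiable_continuous.
  by apply/derivable1_diffP; case: (fd x).
by rewrite normrM ler_wpM2r.
Qed.

Lemma trig_lipschitz b u v : `|trig b u - trig b v| <= `|u - v|.
Proof.
have := derive_lipschitz (is_derive_trig b) (@dtrig_le1 b) u v.
by rewrite mul1r.
Qed.

(** The mean value theorem for [f], the function minus its linear part at [v], whose derivative at
    [t] is at most [|t - v|]. *)
Lemma trig_taylor b v u :
  `|trig b u - trig b v - dtrig b v * (u - v)| <= (u - v) ^+ 2.
Proof.
pose f (t : R) := trig b t - dtrig b v * t.
have fE : trig b u - trig b v - dtrig b v * (u - v) = f u - f v by rewrite /f; ring.
have dfl t : `|dtrig b t - dtrig b v| <= `|t - v|.
  have := @derive_lipschitz (dtrig b) (fun x => - trig b x) 1 (is_derive_dtrig b) _ t v.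
  by rewrite mul1r; apply => x; rewrite normrN trig_le1.
have fd t : is_derive t 1 f (dtrig b t - dtrig b v).
  rewrite /f; apply: is_deriveB; first exact: is_derive_trig.
  have -> : dtrig b v = dtrig b v *: (1 : R) by rewrite /GRing.scale /= mulr1.
  by rewrite {1}/GRing.scale /= mulr1; exact: is_deriveZ.
have fc : forall w z, {within `[w, z], continuous f}.
  move=> w z; apply: continuous_subspaceT => x; apply: differentiable_continuous.
  by apply/derivable1_diffP; case: (fd x).
rewrite fE -real_normK ?num_real // expr2.
have [uv|/ltW uv] := leP v u.
  have [c cI ->] := MVT_segment uv (fun x _ => fd x) (@fc v u).
  rewrite normrM ler_wpM2r // (le_trans (dfl c)) //.
  by move: cI; rewrite in_itv /= => /andP[c1 c2]; rewrite !ger0_norm ?subr_ge0 // lerB.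
have [c cI] := MVT_segment uv (fun x _ => fd x) (@fc u v).
rewrite distrC => ->; rewrite normrM [`|v - u|]distrC ler_wpM2r // (le_trans (dfl c)) //.
move: cI; rewrite in_itv /= => /andP[c1 c2].
by rewrite distrC (distrC u) !ger0_norm ?subr_ge0 // lerB.
Qed.

Lemma prod_norm_le1 (I : Type) (r : seq I) (P : pred I) (a : I -> R) :
  (forall i, `|a i| <= 1) -> `|\prod_(i <- r | P i) a i| <= 1.
Proof.
move=> a1; rewrite normr_prod; apply: prodr_ile1 => i _.
by rewrite normr_ge0 a1.
Qed.

Lemma prod_lipschitz (I : Type) (r : seq I) (a b : I -> R) :
  (forall i, `|a i| <= 1) -> (forall i, `|b i| <= 1) ->
  `|\prod_(i <- r) b i - \prod_(i <- r) a i| <= \sum_(i <- r) `|b i - a i|.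
Proof.
move=> a1 b1; elim: r => [|i r IH]; first by rewrite !big_nil subrr normr0.
rewrite !big_cons.
set A := \prod_(_ <- _) a _; set B := \prod_(_ <- _) b _.
have -> : b i * B - a i * A = (b i - a i) * B + a i * (B - A) by ring.
rewrite (le_trans (ler_normD _ _)) // lerD // normrM.
  by rewrite ler_piMr // prod_norm_le1.
by rewrite (le_trans _ IH) // ler_piMl.
Qed.

(** Induction on the list: the new error is the error of the tail, plus the increment of the first
    factor times that of the tail, which [prod_lipschitz] bounds. *)
Lemma prod_taylor (I : eqType) (r : seq I) (a b : I -> R) : uniq r ->
  (forall i, `|a i| <= 1) -> (forall i, `|b i| <= 1) ->
  `|\prod_(i <- r) b i - \prod_(i <- r) a i
    - \sum_(i <- r) (b i - a i) * \prod_(j <- r | j != i) a j|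
  <= (\sum_(i <- r) `|b i - a i|) ^+ 2.
Proof.
move=> ur a1 b1; elim: r ur => [|i r IH] /=.
  by move=> _; rewrite !big_nil subrr subr0 normr0 expr0n.
move=> /andP[ir /IH {}IH]; rewrite !big_cons eqxx /=.
have -> : \prod_(j <- r | j != i) a j = \prod_(j <- r) a j.
  rewrite big_seq_cond [RHS]big_seq; apply: eq_bigl => j.
  by case: (boolP (j \in r)) => //= jr; apply: contraNneq ir => <-.
have -> : \sum_(j <- r) (b j - a j) * \prod_(l <- i :: r | l != j) a l
        = a i * \sum_(j <- r) (b j - a j) * \prod_(l <- r | l != j) a l.
  rewrite mulr_sumr big_seq [RHS]big_seq; apply: eq_bigr => j jr.
  rewrite big_cons ifT; first by rewrite mulrCA.
  by apply: contraNneq ir => ->.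
have L := prod_lipschitz r a1 b1; move: L IH.
set A := \prod_(_ <- _) a _; set B := \prod_(_ <- _) b _.
set D := \sum_(_ <- _) _ * _; set S := \sum_(_ <- _) `|_| => L IH.
have -> : b i * B - a i * A - ((b i - a i) * A + a i * D)
  = (b i - a i) * (B - A) + a i * (B - A - D) by ring.
have S0 : 0 <= S by exact: sumr_ge0.
have h1 : `|(b i - a i) * (B - A)| <= `|b i - a i| * S by rewrite normrM ler_wpM2l.
have h2 : `|a i * (B - A - D)| <= S ^+ 2.
  by rewrite normrM (le_trans _ IH) // ler_piMl.
have := ler_normD ((b i - a i) * (B - A)) (a i * (B - A - D)).
have := normr_ge0 (b i - a i); move: h1 h2; set x := `|b i - a i| => h1 h2 x0 h3.
have : 0 <= x * S by rewrite mulr_ge0.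
have := sqr_ge0 x; rewrite sqrrD; lra.
Qed.

(** * Squared products of sines and cosines in [N] variables *)

Variables (N : nat) (om : R).
Hypothesis om0 : 0 < om.
Implicit Types (y : {ffun 'I_N -> bool}) (x : 'rV[R]_N).

Definition trigprod y x : R := \prod_i trig (y i) (om * x 0 i).

Definition trigprod_grad y x : 'rV[R]_N :=
  \row_i (om * \prod_j (if j == i then dtrig (y j) (om * x 0 j)
                        else trig (y j) (om * x 0 j))).

Definition tent y x : R := trigprod y x ^+ 2.

Definition tent_grad y x : 'rV[R]_N := (2 * trigprod y x) *: trigprod_grad y x.

(** Multiply out the product over [i] of [cos ^+ 2 + sin ^+ 2]. *)
Lemma tent_sum x : \sum_y tent y x = 1.
Proof.
under eq_bigr do rewrite /tent /trigprod -prodrXl.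
rewrite -(bigA_distr_bigA (fun i b => trig b (om * x 0 i) ^+ 2)) /=.
by apply: big1 => i _; rewrite big_bool /= addrC cos2Dsin2.
Qed.

Lemma trigprod_le1 y x : `|trigprod y x| <= 1.
Proof. by apply: prod_norm_le1 => i; exact: trig_le1. Qed.

Lemma tent_ge0 y x : 0 <= tent y x.
Proof. exact: sqr_ge0. Qed.

Lemma tent_le1 y x : tent y x <= 1.
Proof. by rewrite /tent -real_normK ?num_real // expr_le1 // trigprod_le1. Qed.

Lemma sum_coord_le x : \sum_i `|x 0 i| <= N%:R * eucl_norm x.
Proof.
apply: (@le_trans _ _ (\sum_(i < N) eucl_norm x)).
  by apply: ler_sum => i _; exact: coord_le_enorm.
by rewrite sumr_const card_ord mulr_natl.
Qed.

Lemma trigprod_lipschitz y x x0 :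
  `|trigprod y x - trigprod y x0| <= om * N%:R * eucl_norm (x - x0).
Proof.
apply: le_trans (prod_lipschitz _ _ _) _ => [i|i|]; rewrite ?trig_le1 //.
rewrite -mulrA (le_trans _ (ler_wpM2l (ltW om0) (sum_coord_le _))) //.
rewrite mulr_sumr; apply: ler_sum => i _; apply: le_trans (trig_lipschitz _ _ _) _.
by rewrite -mulrBr normrM gtr0_norm // !mxE.
Qed.

Lemma trigprod_taylor y x x0 :
  `|trigprod y x - trigprod y x0 - dotv (trigprod_grad y x0) (x - x0)|
   <= om ^+ 2 * (1 + N%:R ^+ 2) * eucl_norm (x - x0) ^+ 2.
Proof.
pose a i := trig (y i) (om * x0 0 i); pose b i := trig (y i) (om * x 0 i).
have a1 i : `|a i| <= 1 by rewrite trig_le1.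
have b1 i : `|b i| <= 1 by rewrite trig_le1.
have := prod_taylor (index_enum_uniq 'I_N) a1 b1.
rewrite -/(trigprod y x) -/(trigprod y x0) => h.
pose S := \sum_i (b i - a i) * \prod_(j | j != i) a j.
have h2 : `|S - dotv (trigprod_grad y x0) (x - x0)| <= om ^+ 2 * eucl_norm (x - x0) ^+ 2.
  rewrite enorm_sqr !dotvE mulr_sumr -sumrB (le_trans (ler_norm_sum _ _ _)) //.
  apply: ler_sum => i _; rewrite [trigprod_grad _ _ _ _]mxE [X in om * X](bigD1 i) //= eqxx.
  have -> : \prod_(j < N | j != i) (if j == i then dtrig (y j) (om * x0 0 j)
     else trig (y j) (om * x0 0 j)) = \prod_(j < N | j != i) a j.
    by apply: eq_bigr => j /negPf ->.
  set P := \prod_(_ < _ | _) _.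
  have P1 : `|P| <= 1 by exact: prod_norm_le1.
  have t := trig_taylor (y i) (om * x0 0 i) (om * x 0 i).
  have -> : (x - x0) 0 i = x 0 i - x0 0 i by rewrite !mxE.
  rewrite [X in `|X|](_ : _ = (b i - a i - dtrig (y i) (om * x0 0 i) * (om * x 0 i - om * x0 0 i)) * P);
    last by rewrite /b; ring.
  rewrite normrM (le_trans (ler_piMr _ P1)) // (le_trans t) //.
  by rewrite le_eqVlt; apply/orP; left; apply/eqP; ring.
have h3 : (\sum_i `|b i - a i|) ^+ 2 <= om ^+ 2 * N%:R ^+ 2 * eucl_norm (x - x0) ^+ 2.
  rewrite -!exprMn ler_sqr ?nnegrE ?sumr_ge0 ?mulr_ge0 ?enorm_ge0 //; last exact: ltW.
  rewrite -mulrA (le_trans _ (ler_wpM2l (ltW om0) (sum_coord_le _))) //.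
  rewrite mulr_sumr; apply: ler_sum => i _; apply: le_trans (trig_lipschitz _ _ _) _.
  by rewrite -mulrBr normrM gtr0_norm // !mxE.
have := ler_normD (trigprod y x - trigprod y x0 - S) (S - dotv (trigprod_grad y x0) (x - x0)).
rewrite addrA subrK => /le_trans; apply.
apply: le_trans (lerD h h2) _; apply: le_trans (lerD h3 (lexx _)) _.
by rewrite le_eqVlt; apply/orP; left; apply/eqP; ring.
Qed.

Lemma enorm_trigprod_grad y x : eucl_norm (trigprod_grad y x) <= om * N%:R.
Proof.
apply: le_trans (enorm_le_sum _) _.
apply: (@le_trans _ _ (\sum_(i < N) om)).
  apply: ler_sum => i _; rewrite mxE normrM gtr0_norm // (ler_piMr (ltW om0)) //.
  apply: prod_norm_le1 => j; case: ifP => _; [exact: dtrig_le1|exact: trig_le1].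
by rewrite sumr_const card_ord mulr_natr.
Qed.

Lemma enorm_tent_grad y x : eucl_norm (tent_grad y x) <= 2 * om * N%:R.
Proof.
rewrite enormZ normrM normr_nat -!mulrA ler_wpM2l // -[leRHS]mul1r.
by rewrite ler_pM ?enorm_ge0 // ?trigprod_le1 // enorm_trigprod_grad.
Qed.

Lemma tent_lipschitz y x x0 :
  `|tent y x - tent y x0| <= 2 * om * N%:R * eucl_norm (x - x0).
Proof.
rewrite /tent subr_sqr normrM mulrC -!mulrA ler_pM // ?mulrA ?trigprod_lipschitz //.
rewrite (le_trans (ler_normD _ _)) //.
by rewrite (_ : 2 = 1 + 1) // lerD // trigprod_le1.
Qed.

Lemma tent_taylor y x x0 :
  `|tent y x - tent y x0 - dotv (tent_grad y x0) (x - x0)|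
   <= om ^+ 2 * (2 + 3 * N%:R ^+ 2) * eucl_norm (x - x0) ^+ 2.
Proof.
have T := trigprod_taylor y x x0; have L := trigprod_lipschitz y x x0.
rewrite /tent_grad dotvZl /tent.
set g := trigprod y x in T L *; set g0 := trigprod y x0 in T L *.
set z := dotv _ _ in T *.
have -> : g ^+ 2 - g0 ^+ 2 - 2 * g0 * z = 2 * (g0 * (g - g0 - z)) + (g - g0) ^+ 2 by ring.
have g1 : `|g0| <= 1 by exact: trigprod_le1.
have h1 : `|2 * (g0 * (g - g0 - z))| <= 2 * (om ^+ 2 * (1 + N%:R ^+ 2) * eucl_norm (x - x0) ^+ 2).
  rewrite normrM normr_nat ler_wpM2l // normrM (le_trans (ler_piMl _ g1)) //.
have h2 : `|(g - g0) ^+ 2| <= (om * N%:R * eucl_norm (x - x0)) ^+ 2.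
  by rewrite normrX ler_sqr ?nnegrE ?mulr_ge0 ?enorm_ge0 // ltW.
apply: le_trans (ler_normD _ _) _; apply: le_trans (lerD h1 h2) _.
by rewrite le_eqVlt; apply/orP; left; apply/eqP; ring.
Qed.

(** The sum over [y] factorises over the coordinates. For [i != l] the factor at [i] is
    [sin * cos - cos * sin = 0]; for [i = l] every factor is one. Thus the gradients form a tight
    frame with constant [om ^+ 2], independent of [N]. *)
Lemma trigprod_grad_orth x i l :
  \sum_y trigprod_grad y x 0 i * trigprod_grad y x 0 l = om ^+ 2 * (i == l)%:R.
Proof.
pose t k (j : 'I_N) b := if j == k then dtrig b (om * x 0 j) else trig b (om * x 0 j).
transitivity (om ^+ 2 * \sum_(y : {ffun 'I_N -> bool}) \prod_j (t i j (y j) * t l j (y j))).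
  rewrite mulr_sumr; apply: eq_bigr => y _; rewrite !mxE big_split /=.
  by rewrite /t; ring.
rewrite -(bigA_distr_bigA (fun j b => t i j b * t l j b)) /=; congr (_ * _).
have cs (z : R) : cos z * cos z + sin z * sin z = 1 by rewrite -!expr2 cos2Dsin2.
have [<-|il] := eqVneq i l.
  apply: big1 => j _; rewrite big_bool /= /t /dtrig /trig.
  by case: ifP => _; rewrite ?mulrNN ?cs // addrC cs.
rewrite (bigD1 i) //= big_bool /= /t eqxx (negPf il) /dtrig /trig.
by rewrite mulNr (mulrC (sin _)) subrr mul0r.
Qed.

Lemma sum_dotv_trigprod_grad x (v : 'rV[R]_N) :
  \sum_y dotv (trigprod_grad y x) v ^+ 2 = om ^+ 2 * dotv v v.
Proof.
transitivity (\sum_i \sum_l v 0 i * v 0 l *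
    \sum_y trigprod_grad y x 0 i * trigprod_grad y x 0 l).
  under eq_bigr do rewrite dotvE expr2 mulr_suml.
  rewrite exchange_big /=; apply: eq_bigr => i _.
  under eq_bigr do rewrite mulr_sumr.
  rewrite exchange_big /=; apply: eq_bigr => l _.
  by rewrite mulr_sumr; apply: eq_bigr => y _; ring.
rewrite dotvE mulr_sumr; apply: eq_bigr => i _.
rewrite (bigD1 i) //= [X in _ + X]big1 => [|l li]; rewrite trigprod_grad_orth.
  by rewrite eqxx addr0 mulr1; ring.
by rewrite eq_sym (negPf li) !mulr0.
Qed.

(* AM-GM against the weights [trigprod y x ^+ 2], which sum to one, replaces
   the sum of norms by a sum of squares; the latter is a trace. *)
Lemma sum_enorm_tent_grad k (E : 'M[R]_(k, N)) x : contractive E ->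
  \sum_y eucl_norm (tent_grad y x *m E^T) <= 2 * om * Num.sqrt k%:R.
Proof.
move=> hE; case: k E hE => [|k] E hE.
  rewrite sqrtr0 mulr0 big1 // => y _.
  by rewrite [X in eucl_norm X](_ : _ = 0) ?enorm0 //; apply/rowP => -[].
set c := Num.sqrt _; have c0 : 0 < c by rewrite sqrtr_gt0.
(* This weight balances the two halves: the tents sum to one and the squares to at most [T ^+ 2]. *)
pose T := om * c; have T0 : 0 < T by rewrite mulr_gt0.
pose G y := eucl_norm (trigprod_grad y x *m E^T).
have GE y : eucl_norm (tent_grad y x *m E^T) <= T * tent y x + T^-1 * G y ^+ 2.
  rewrite -scalemxAl enormZ -/(G y) normrM normr_nat /tent -(real_normK (num_real (trigprod y x))).
  have -> : T * `|trigprod y x| ^+ 2 + T^-1 * G y ^+ 2 =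
    T^-1 * (T * `|trigprod y x| - G y) ^+ 2 + 2 * `|trigprod y x| * G y.
    by field; rewrite gt_eqF.
  by rewrite lerDr mulr_ge0 ?sqr_ge0 // invr_ge0 ltW.
apply: (@le_trans _ _ (\sum_y (T * tent y x + T^-1 * G y ^+ 2))).
  exact: ler_sum.
rewrite big_split /= -!mulr_sumr tent_sum.
have : \sum_y G y ^+ 2 <= om ^+ 2 * k.+1%:R.
  have -> : \sum_y G y ^+ 2 = \sum_j \sum_y dotv (trigprod_grad y x) (row j E) ^+ 2.
    rewrite exchange_big /=; apply: eq_bigr => y _.
    rewrite enorm_sqr dotvE; apply: eq_bigr => j _; rewrite -expr2; congr (_ ^+ 2).
    by rewrite dotvE mxE; apply: eq_bigr => l _; rewrite !mxE.
  apply: (@le_trans _ _ (\sum_(j < k.+1) om ^+ 2)).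
    apply: ler_sum => j _; rewrite sum_dotv_trigprod_grad -enorm_sqr ler_piMr ?sqr_ge0 //.
    by rewrite expr_le1 ?enorm_ge0 // contraction_row.
  by rewrite sumr_const card_ord mulr_natr.
have Ti : 0 <= T^-1 by rewrite invr_ge0 ltW.
move=> /(ler_wpM2l Ti) /(lerD (lexx (T * 1))) /le_trans; apply.
rewrite -[k.+1%:R]sqr_sqrtr ?ler0n // -/c.
by rewrite le_eqVlt; apply/orP; left; apply/eqP; rewrite /T; field; rewrite !gt_eqF.
Qed.

End TrigPartition.

(** * Greedy choice of a foam *)

Section Foam.
Variables (R : realType) (Y : finType) (X : Type) (f : Y -> X -> R).
Implicit Types (F : seq (Y * R)) (x : X).

(* A foam is a list of droplets [(y, h)], [h] being a level of [f y]; [x] lies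
   in an open cell if the first closed droplet [f y >= h] containing it contains
   it in its interior [f y > h]. *)
Fixpoint in_cell F x : Prop :=
  if F is (y, h) :: F' then h < f y x \/ f y x < h /\ in_cell F' x else False.

(** A positive level keeps a closed droplet inside the open set where its function is positive. *)
Definition levels_in01 F := forall p, p \in F -> 0 < p.2 < 1.

(** For [h] uniform in []0, 1[], a piece with lower bound [m] survives only if [h >= m], with
    probability [1 - m]; the potential [v] is then still owed. *)
Lemma integral_step (c : R -> R) (v m : R) (C : R) :
  measurable_fun setT c -> (forall h, 0 <= c h) -> 0 <= v -> 0 <= m <= 1 ->
  (\int[lebesgue_measure]_(h in `]0%R, 1%R[) (c h)%:E <= C%:E)%E ->
  (\int[lebesgue_measure]_(h in `]0%R, 1%R[)
     (c h + v * (\1_(`[m, 1]%classic : set R) h))%:E <= (C + v * (1 - m))%:E)%E.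
Proof.
move=> mc c0 v0 /andP[m0 m1] hC.
under eq_integral do rewrite EFinD EFinM.
rewrite ge0_integralD //=; first last.
- by apply/measurable_EFinP; apply: measurable_funM => //; exact: measurable_indic.
- by move=> h _; rewrite mule_ge0 // lee_fin.
- by apply/measurable_EFinP/measurable_funTS.
- by move=> h _; rewrite lee_fin.
rewrite EFinD leeD // ge0_integralZl //=; first last.
- by apply/measurable_EFinP; exact: measurable_indic.
rewrite integral_indic //= EFinM lee_wpmul2l // ?lee_fin //.
apply: (@le_trans _ _ (lebesgue_measure (`[m, 1]%classic : set R))).
  by apply: le_measure; rewrite ?inE //=; exact: measurableI.
rewrite lebesgue_measure_itv /= lte_fin; case: ifPn => // _.
by rewrite lee_fin subr_ge0.
Qed.

(** [I] indexes the pieces. [m i y] is meant as a lower bound of [f y] on the piece [i], [c i y h]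
    as the cost of cutting it by the level [h] of [f y], [C i y] bounds the mean of this cost over
    [h], and [v i] is the potential. The slack [g] makes the greedy choice terminate. *)
Variables (I : finType) (m : I -> Y -> R) (c : I -> Y -> R -> R).
Variables (C : I -> Y -> R) (v : I -> R) (g : R).
Hypotheses (g0 : 0 < g) (Y0 : (0 < #|Y|)%N).
Hypothesis m01 : forall i y, 0 <= m i y <= 1.
Hypothesis v0 : forall i, 0 <= v i.
Hypothesis c0 : forall i y h, 0 <= c i y h.
Hypothesis mc : forall i y, measurable_fun setT (c i y).
Hypothesis cC : forall i y,
  (\int[lebesgue_measure]_(h in `]0%R, 1%R[) (c i y h)%:E <= (C i y)%:E)%E.
Hypothesis CV : forall i, \sum_y C i y + g <= v i * \sum_y m i y.

(** The drop of potential guaranteed per droplet. On average over [y] it is at least [g / #|Y|];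
    taking half of this turns a nonstrict inequality of integrals into a contradiction. *)
Let g' := g / (2 * #|Y|%:R).

(* The potential [v i] of a piece not yet swallowed by a droplet is its expected
   cut cost per droplet divided by the probability of being swallowed, hence it
   pays in expectation for all its future cuts. *)
Lemma foam_step (A : {set I}) : A != finset.set0 ->
  exists y h, 0 < h < 1 /\
    \sum_(i in A) (c i y h + v i * (m i y <= h)%R%:R) <= \sum_(i in A) v i - g'.
Proof.
move=> /set0Pn[i0 i0A]; apply: contrapT => hn.
(* If every choice failed, integrating over [h] and summing over [y] would contradict [CV]. *)
have hlt y h : 0 < h < 1 ->
    \sum_(i in A) v i - g' < \sum_(i in A) (c i y h + v i * (m i y <= h)%R%:R).
  move=> h01; rewrite ltNge; apply/negP => hle; apply: hn.
  by exists y, h.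
have Y1 : 0 < #|Y|%:R :> R by rewrite ltr0n.
(* Comparing integrals requires nonnegative integrands. Since [m <= 1], [CV] forces
   [g <= v i0 * #|Y|%:R]. *)
have Vg : 0 <= \sum_(i in A) v i - g'.
  rewrite subr_ge0 (bigD1 i0) //=.
  have s0 : 0 <= \sum_(i in A | i != i0) v i by exact: sumr_ge0.
  have vi : g <= v i0 * #|Y|%:R.
    apply: (@le_trans _ _ (v i0 * \sum_y m i0 y)).
      apply: le_trans (CV i0); rewrite lerDr sumr_ge0 // => y _.
      rewrite -lee_fin; apply: le_trans (cC i0 y).
      by apply: integral_ge0 => h _; rewrite lee_fin.
    rewrite ler_wpM2l // -sum1_card natr_sum; apply: ler_sum => y _.
    by case/andP: (m01 i0 y).
  have : g' <= v i0.
    rewrite /g' ler_pdivrMr ?mulr_gt0 //.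
    by rewrite mulrCA (le_trans vi) // ler_peMl ?mulr_ge0 // ler1n.
  by lra.
have up y : \sum_(i in A) v i - g' <= \sum_(i in A) (C i y + v i * (1 - m i y)).
  rewrite -lee_fin -sumEFin.
  apply: (@le_trans _ _ (\sum_(i in A) \int[lebesgue_measure]_(h in `]0%R, 1%R[)
     (c i y h + v i * (\1_(`[m i y, 1]%classic : set R) h))%:E)%E); last first.
    by apply: lee_sum => i _; apply: integral_step.
  have mF i : measurable_fun (`]0%R, 1%R[%classic : set R)
      (fun h => (c i y h + v i * (\1_(`[m i y, 1]%classic : set R) h))%:E).
    apply/measurable_EFinP; apply: measurable_funD; first exact/measurable_funTS.
    by apply: measurable_funM => //; exact: measurable_indic.
  have F0 i h : (0 <= (c i y h + v i * (\1_(`[m i y, 1]%classic : set R) h))%:E)%E.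
    by rewrite lee_fin addr_ge0 // mulr_ge0.
  rewrite -[X in (_ <= X)%E]big_enum /= -ge0_integral_sum //.
  have -> : (\sum_(i in A) v i - g')%:E = (\int[lebesgue_measure]_(h in `]0%R, 1%R[)
       cst (\sum_(i in A) v i - g')%:E h)%E.
    rewrite integral_cst //= lebesgue_measure_itv /= lte01 -EFinB subr0 mule1 //.
  apply: ge0_le_integral => //=.
  - by apply: emeasurable_sum.
  - move=> h; rewrite in_itv /= => h01; rewrite sumEFin lee_fin big_enum /=.
    apply: le_trans (ltW (hlt y h h01)) _; apply: ler_sum => i _.
    rewrite lerD2l ler_wpM2l // indicE.
    have [mh|] := leP (m i y) h; last by rewrite ler0n.
    by rewrite mem_set //= in_itv /= mh /= ltW //; case/andP: h01.
have : \sum_(y : Y) (\sum_(i in A) v i - g') <= \sum_y \sum_(i in A) (C i y + v i * (1 - m i y)).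
  by apply: ler_sum.
rewrite exchange_big /= sumr_const -[in X in X <= _]mulr_natr.
have : \sum_(i in A) \sum_y (C i y + v i * (1 - m i y)) <=
    \sum_(i in A) (v i * #|Y|%:R) - g.
  rewrite (bigD1 i0) //= [in leRHS](bigD1 i0) //=.
  have bd i : \sum_y (C i y + v i * (1 - m i y)) <= v i * #|Y|%:R - g.
    rewrite big_split /= -mulr_sumr sumrB.
    have -> : \sum_(y : Y) 1 = #|Y|%:R :> R by rewrite sumr_const.
    by have := CV i; lra.
  rewrite addrAC lerD // ler_sum // => i _; apply: le_trans (bd i) _.
  by rewrite lerBlDr lerDl ltW.
move=> /[swap] /le_trans /[apply]; rewrite -mulr_suml mulrBl.
have -> : g' * #|Y|%:R = g / 2 by rewrite /g'; field; rewrite gt_eqF.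
by have := g0; lra.
Qed.

(** The droplets laid before the first one that certainly swallows the whole piece [i]; only these
    can cut it. *)
Fixpoint cuts i F : seq (Y * R) :=
  if F is (y, h) :: F' then (if h < m i y then [::] else (y, h) :: cuts i F')
  else [::].

Definition killed i F := has (fun p => p.2 < m i p.1) F.

(** Iterate [foam_step] on the pieces not yet killed. The potential falls by [g'] with each droplet,
    so that the process ends, and the costs telescope against the initial potential. *)
Lemma foam_greedy_set (A : {set I}) :
  exists F, [/\ levels_in01 F, forall i, i \in A -> killed i F &
    \sum_(i in A) \sum_(p <- cuts i F) c i p.1 p.2 <= \sum_(i in A) v i].
Proof.
have g'0 : 0 < g' by rewrite divr_gt0 // mulr_gt0 // ltr0n.
have [n hn] : exists n : nat, \sum_(i in A) v i < n%:R * g'.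
  exists (Num.truncn ((\sum_(i in A) v i) / g')).+1.
  rewrite -ltr_pdivrMr //; exact: truncnS_gt.
elim: n A hn => [|n IH] A.
  by rewrite mul0r ltNge sumr_ge0.
move=> hA; have [->|A0] := eqVneq A finset.set0.
  by exists [::]; split=> // [i|]; rewrite ?inE // !big_set0.
have [y [h [h01 hs]]] := foam_step A0.
pose B := [set i in A | m i y <= h]%SET.
have BA : \sum_(i in B) v i = \sum_(i in A) v i * (m i y <= h)%R%:R.
  rewrite big_mkcond [RHS]big_mkcond /=; apply: eq_bigr => i _; rewrite inE.
  by case: (i \in A) => //=; case: ifP; rewrite ?mulr1 ?mulr0.
have cs : 0 <= \sum_(i in A) c i y h by exact: sumr_ge0.
rewrite big_split /= -BA in hs.
have [|F [F01 kF cF]] := IH B.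
  by move: hA; rewrite -[n.+1%:R]natr1 mulrDl mul1r; lra.
exists ((y, h) :: F); split.
- by move=> p; rewrite inE => /predU1P[->|/F01].
- move=> i iA; rewrite /killed /=; have [//|hm] := ltP h (m i y).
  by apply: kF; rewrite inE iA.
- rewrite /=; apply: (@le_trans _ _ (\sum_(i in A) c i y h +
     \sum_(i in B) \sum_(p <- cuts i F) c i p.1 p.2)); last by have := ltW g'0; lra.
  rewrite [X in _ <= _ + X]big_mkcond [X in _ <= X + _]big_mkcond -big_split big_mkcond /=.
  apply: ler_sum => i _; rewrite inE; case: (i \in A); rewrite ?addr0 //=.
  by have [hm|hm] := ltP h (m i y); rewrite /= ?big_nil ?addr0 ?big_cons.
Qed.

Lemma foam_greedy :
  exists F, [/\ levels_in01 F, forall i, killed i F &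
    \sum_i \sum_(p <- cuts i F) c i p.1 p.2 <= \sum_i v i].
Proof.
have [F [F1 F2 F3]] := foam_greedy_set finset.setT; exists F; split => // [i|].
  by apply: F2; rewrite inE.
have inT i : (i \in finset.setT) = true by rewrite inE.
move: F3; rewrite (eq_bigl xpredT) // => /le_trans; apply.
by rewrite (eq_bigl xpredT).
Qed.

(** The killing droplet has [x] in its interior, so the first closed droplet containing [x] comes no
    later. If [x] is not interior to that one, it lies on its level, and the droplet is one of the
    cuts. *)
Lemma foam_cover i F x : (forall y, m i y <= f y x) -> killed i F ->
  in_cell F x \/ exists2 p, p \in cuts i F & f p.1 x = p.2.
Proof.
move=> mf; elim: F => [//|[y h] F IH] /=.
have [hm|mh] := ltP h (m i y).
  by move=> _; left; left; exact: lt_le_trans hm (mf y).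
move=> /IH {}IH; case: (ltgtP h (f y x)) => [|hf|hE]; first by left; left.
  case: IH => [xF|[p pF fp]]; first by left; right.
  by right; exists p => //; rewrite inE pF orbT.
by right; exists (y, h); rewrite ?inE ?eqxx.
Qed.

End Foam.

(** * Slices of flat pieces *)

Section Pieces.
Variables (R : realType) (N : nat) (om lam : R).
Hypotheses (om0 : 0 < om) (lam0 : 0 < lam).
Local Notation Y := {ffun 'I_N -> bool}.
Local Notation X := 'rV[R]_N.
Implicit Types (S : set X) (k : nat).
Local Notation tent := (@tent R N om).
Local Notation tent_grad := (@tent_grad R N om).

(** The integrand is an unnormalised Gaussian of standard deviation [s / Num.sqrt (2 * lam)];
    extending the integral to the line yields the normalising constant. *)
Lemma gauss_integral_le (s mu : R) : 0 < s ->
  (\int[lebesgue_measure]_(h in `]0%R, 1%R[)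
     (expR (- (lam * ((h - mu) / s) ^+ 2)))%:E <= (s * Num.sqrt (pi / lam))%:E)%E.
Proof.
move=> s0; pose sg := s / Num.sqrt (2 * lam).
have l0 : 0 < Num.sqrt (2 * lam) by rewrite sqrtr_gt0 mulr_gt0.
have sg0 : 0 < sg by rewrite divr_gt0.
have l2 : Num.sqrt (2 * lam) ^+ 2 = 2 * lam by rewrite sqr_sqrtr // mulr_ge0 // ltW.
have sgE : sg ^+ 2 = s ^+ 2 / (2 * lam) by rewrite /sg expr_div_n l2.
have fE h : expR (- (lam * ((h - mu) / s) ^+ 2)) = normal_fun mu sg h.
  rewrite /normal_fun sgE; congr expR; rewrite -mulr_natr; field.
  by rewrite !gt_eqF.
have mf : measurable_fun setT (EFin \o normal_fun mu sg).
  by apply/measurable_EFinP; exact: measurable_normal_fun.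
under eq_integral do rewrite fE.
apply: (@le_trans _ _ (\int[lebesgue_measure]_x (EFin \o normal_fun mu sg) x)%E).
  apply: ge0_subset_integral => //.
  by move=> h _; rewrite lee_fin; exact: expR_ge0.
have pk0 : normal_peak sg != 0 by rewrite gt_eqF // normal_peak_gt0 // gt_eqF.
have -> : (\int[lebesgue_measure]_x (EFin \o normal_fun mu sg) x =
           (normal_peak sg)^-1%:E)%E.
  have := integral_normal_pdf mu sg.
  rewrite /normal_pdf gt_eqF //.
  under eq_integral do rewrite EFinM.
  rewrite ge0_integralZl //=; last first.
  - by rewrite lee_fin normal_peak_ge0.
  - by move=> x _; rewrite lee_fin; exact: expR_ge0.
  move=> /(congr1 (fun z => (normal_peak sg)^-1%:E * z)%E).
  by rewrite muleA -EFinM mulVf // mul1e mule1.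
have h1 : 0 <= s ^+ 2 / (2 * lam) * pi *+ 2.
  apply: mulrn_wge0; apply: mulr_ge0 (pi_ge0 R); apply: divr_ge0; first exact: sqr_ge0.
  by apply: mulr_ge0 => //; exact: ltW.
have h2 : 0 <= pi / lam by rewrite divr_ge0 ?pi_ge0 ?ltW.
rewrite lee_fin /normal_peak invrK sgE -(@ler_pXn2r _ 2) ?nnegrE ?sqrtr_ge0 //.
  rewrite exprMn !sqr_sqrtr //.
  by rewrite le_eqVlt; apply/orP; left; apply/eqP; rewrite -mulr_natr; field; rewrite gt_eqF.
by rewrite mulr_ge0 ?sqrtr_ge0 // ltW.
Qed.

(** The scale [d] stays fixed under slicing, while the squared radius [b], in units of [d ^+ 2],
    shrinks. For [d > 0] a negative [b] forces [S] to be empty, so slices that miss the ball need no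
    separate case. *)
Definition flat_in k (E : 'M[R]_(k, N)) (x0 : X) (d b eps : R) S :=
  contractive E /\ forall x, S x ->
    exists a : 'rV_k, dotv a a <= b * d ^+ 2 /\ eucl_norm (x - x0 - a *m E) <= eps * d.

Definition diam_le (d : R) S := forall x x', S x -> S x' -> eucl_norm (x - x') <= d.

Lemma flat_in_dist k (E : 'M[R]_(k, N)) x0 d b eps S B x :
  flat_in E x0 d b eps S -> 0 < d -> b <= B -> 0 <= B -> eps <= 1 -> S x ->
  eucl_norm (x - x0) <= (Num.sqrt B + 1) * d.
Proof.
move=> [hE fS] d0 bB B0 e1 /fS[a [ab xe]].
have -> : x - x0 = a *m E + (x - x0 - a *m E) by rewrite [RHS]addrC subrK.
apply: le_trans (enormD _ _) _; rewrite mulrDl mul1r lerD //.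
  apply: le_trans (hE _) _; rewrite enorm_leP; last by rewrite mulr_ge0 ?sqrtr_ge0 // ltW.
  by rewrite exprMn sqr_sqrtr // (le_trans ab) // ler_wpM2r // sqr_ge0.
by rewrite (le_trans xe) // ler_piMl // ltW.
Qed.

Lemma flat_in_diam k (E : 'M[R]_(k, N)) x0 d b eps S B :
  flat_in E x0 d b eps S -> 0 < d -> b <= B -> 0 <= B -> eps <= 1 ->
  diam_le (2 * (Num.sqrt B + 1) * d) S.
Proof.
move=> fl d0 bB B0 e1 x x' Sx Sx'.
apply: le_trans (enorm_trans x0 _ _) _; rewrite (enormBC x0).
have := flat_in_dist fl d0 bB B0 e1 Sx; have := flat_in_dist fl d0 bB B0 e1 Sx'.
by lra.
Qed.

Let L := 2 * om * N%:R.
Let Q := om ^+ 2 * (2 + 3 * N%:R ^+ 2).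
Let D : R := #|{: Y}|%:R.

Lemma lipschitz_const_ge0 : 0 <= L. Proof. by rewrite /L !mulr_ge0 // ltW. Qed.
Lemma taylor_const_ge0 : 0 <= Q.
Proof. by rewrite /Q mulr_ge0 ?sqr_ge0 // addr_ge0 // mulr_ge0 ?sqr_ge0. Qed.
Lemma card_sign_gt0 : 0 < D.
Proof. by rewrite ltr0n; apply/card_gt0P; exists [ffun=> true]. Qed.

(* On a flat piece the slice [tent y = h] is, up to a small error, an affine
   hyperplane section at signed distance [(h - tent y x0) / |c|] of the centre. *)
Lemma flat_lin k (E : 'M[R]_(k, N)) x0 d b eps S B y x :
  flat_in E x0 d b eps S -> 0 < d -> b <= B -> 0 <= B -> 0 <= eps <= 1 -> S x ->
  exists a : 'rV_k,
    [/\ dotv a a <= b * d ^+ 2, eucl_norm (x - x0 - a *m E) <= eps * d &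
     `|tent y x - tent y x0 - dotv a (tent_grad y x0 *m E^T)|
       <= (L * eps + Q * (Num.sqrt B + 1) ^+ 2 * d) * d].
Proof.
move=> fl d0 bB B0 /andP[e0 e1] Sx; have xd := flat_in_dist fl d0 bB B0 e1 Sx.
case: fl => hE /(_ _ Sx)[a [ab xe]]; exists a; split => //.
have T := tent_taylor om0 y x x0.
have G : `|dotv (tent_grad y x0) (x - x0 - a *m E)| <= L * (eps * d).
  apply: le_trans (dotv_CS _ _) _; rewrite ler_pM ?enorm_ge0 //.
  exact: enorm_tent_grad.
rewrite -(dotv_mulmx a E) (dotvC (a *m E)).
have -> : tent y x - tent y x0 - dotv (tent_grad y x0) (a *m E) =
   (tent y x - tent y x0 - dotv (tent_grad y x0) (x - x0)) +
   dotv (tent_grad y x0) (x - x0 - a *m E).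
  by rewrite (dotvBr (x - x0)) addrA subrK.
apply: le_trans (ler_normD _ _) _; apply: le_trans (lerD T G) _.
rewrite -/Q mulrDl addrC lerD //; first by rewrite mulrA.
have -> : Q * (Num.sqrt B + 1) ^+ 2 * d * d = Q * ((Num.sqrt B + 1) * d) ^+ 2 by ring.
rewrite ler_wpM2l ?taylor_const_ge0 //.
by rewrite ler_sqr ?nnegrE ?enorm_ge0 // mulr_ge0 ?ltW // addr_ge0 ?sqrtr_ge0.
Qed.

(** By [flat_lin], the level pins the coordinate [t] of [a] along the gradient to [th / q], up to
    [e1 / q * d]. Moving the centre to that position, Pythagoras lowers the squared radius by the
    square of the shift; the error goes into [eta] and [eps']. *)
Lemma flat_slice k (E : 'M[R]_(k.+1, N)) x0 d b eps S B y e1 eps' eta h :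
  flat_in E x0 d b eps S -> 0 < d -> b <= B -> 0 <= B -> 0 <= eps <= 1 ->
  L * eps + Q * (Num.sqrt B + 1) ^+ 2 * d <= e1 ->
  let q := eucl_norm (tent_grad y x0 *m E^T) in
  0 < q -> e1 <= q -> eps + e1 / q <= eps' ->
  2 * (Num.sqrt B + 1) * (e1 / q) <= eta ->
  exists (x1 : X) (E' : 'M[R]_(k, N)),
    flat_in E' x1 d (b + eta - ((h - tent y x0) / (q * d)) ^+ 2) eps'
      (S `&` [set x | tent y x = h]).
Proof.
move=> fl d0 bB B0 e01 he1 /=; set c := tent_grad y x0 *m E^T.
set q := eucl_norm c => q0 e1q heps heta.
have c0 : c != 0 by rewrite -enorm_eq0 gt_eqF.
have [hE _] := fl.
have [e [E' [ee hE' split_a]]] := contraction_split hE c0.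
pose th := h - tent y x0; rewrite -/th.
exists (x0 + (th / q) *: e), E'; split => // x [Sx /= fx].
have [a [ab xe lin]] := flat_lin y fl d0 bB B0 e01 Sx.
have [a' [aE aa]] := split_a a.
exists a'; move: lin; rewrite fx -/th -/c => lin.
set t := dotv a c / eucl_norm c in aE aa *.
have et : `|th / q - t| <= e1 / q * d.
  have -> : th / q - t = (th - dotv a c) / q by rewrite [RHS]mulrBl.
  rewrite normrM normfV (gtr0_norm q0) mulrAC ler_pM2r ?invr_gt0 //.
  by rewrite (le_trans lin) // ler_pM2r.
clearbody t.
have e1q1 : e1 / q <= 1 by rewrite ler_pdivrMr // mul1r.
have sB : t ^+ 2 <= (Num.sqrt B * d) ^+ 2.
  rewrite exprMn sqr_sqrtr //; apply: (@le_trans _ _ (b * d ^+ 2)).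
    by move: ab; rewrite aa; have := dotvv_ge0 a'; lra.
  by rewrite ler_wpM2r // sqr_ge0.
have tB : `|t| <= Num.sqrt B * d.
  rewrite -ler_sqr ?nnegrE ?real_normK ?num_real //.
  by rewrite mulr_ge0 ?sqrtr_ge0 // ltW.
split; last first.
  have -> : x - (x0 + (th / q) *: e) - a' *m E' =
     (x - x0 - a *m E) + (t - th / q) *: e.
    by rewrite aE; move: (a' *m E') => p; apply/rowP => i; rewrite !mxE; ring.
  apply: le_trans (enormD _ _) _; rewrite enormZ distrC.
  apply: (@le_trans _ _ (eps * d + e1 / q * d)).
    rewrite lerD // (le_trans _ et) // ler_piMr //.
  by rewrite -mulrDl ler_wpM2r // ltW.
have -> : dotv a' a' = dotv a a - t ^+ 2 by rewrite aa addrC addKr.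
(* Of the factor [2 * (Num.sqrt B + 1)] in the bound on [eta], the part [2 * Num.sqrt B] pays for
   the cross term and the rest for the square of the error. *)
have key : (th / q) ^+ 2 <= t ^+ 2 + eta * d ^+ 2.
  set u := th / q in et *; set z := u - t in et.
  have -> : u = t + z by rewrite /z [RHS]addrC subrK.
  have z0 := normr_ge0 z.
  have h1 : t * z <= Num.sqrt B * d * (e1 / q * d).
    apply: le_trans (ler_norm _) _; rewrite normrM ler_pM //.
  have e1q0 : 0 <= e1 / q by rewrite -(pmulr_lge0 _ d0) (le_trans z0 et).
  have h2 : z ^+ 2 <= (e1 / q) * d ^+ 2.
    rewrite -real_normK ?num_real // (@le_trans _ _ ((e1 / q * d) ^+ 2)) //.
      by rewrite ler_sqr // nnegrE mulr_ge0 // ltW.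
    by rewrite exprMn ler_wpM2r ?sqr_ge0 // expr2 ler_piMr.
  have h3 : 2 * (Num.sqrt B + 1) * (e1 / q) * d ^+ 2 <= eta * d ^+ 2.
    by rewrite ler_wpM2r // sqr_ge0.
  have h4 : 0 <= e1 / q * d ^+ 2 by rewrite mulr_ge0 // sqr_ge0.
  clearbody z; move: h1 h2 h3 h4; move: (e1 / q) (Num.sqrt B) => r1 r2 h1 h2 h3 h4.
  nra.
have -> : (th / (q * d)) ^+ 2 = (th / q) ^+ 2 / d ^+ 2.
  by rewrite -[RHS]expr_div_n invfM mulrA.
have -> : (b + eta - (th / q) ^+ 2 / d ^+ 2) * d ^+ 2 =
  b * d ^+ 2 + eta * d ^+ 2 - (th / q) ^+ 2.
  by rewrite mulrBl mulrDl divfK ?expf_neq0 ?gt_eqF.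
by move: ab key; lra.
Qed.

End Pieces.

(** * Weighted pieces and the mean weight of their slices *)

Section Steps.
Variables (R : realType) (N : nat) (om lam : R).
Hypotheses (om0 : 0 < om) (lam0 : 0 < lam).
Local Notation Y := {ffun 'I_N -> bool}.
Local Notation X := 'rV[R]_N.
Implicit Types (S : set X) (k : nat).
Local Notation tent := (@tent R N om).
Local Notation tent_grad := (@tent_grad R N om).
Local Notation L := (2 * om * N%:R).
Local Notation Q := (om ^+ 2 * (2 + 3 * N%:R ^+ 2)).
Local Notation D := (#|{: Y}|%:R : R).
(** Large enough for [crude_step], where the levels meeting a set of diameter [d] have total length
    at most [2 * D * L * d]; the added one keeps it positive. *)
Let K := 8 * D * L + 1.

(* The weight [w] of a set [S] bounds the contribution of [S] to the expected
   number of common points of [k] independent random foams. *)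
Definition piece k (G eps del B : R) S (w : R) : Prop :=
  0 <= w /\
  [\/ forall x, ~ S x,
      exists (E : 'M[R]_(k, N)) x0 d b,
        [/\ flat_in E x0 d b eps S, 0 < d <= del, b <= B &
            G * expR (lam * b) * d ^+ k <= w]
    | exists d, [/\ diam_le d S, 0 < d <= del & (K * d) ^+ k <= w]].

(** What one greedy round requires of [S], with the weight as potential. The bound [1 / 2] on the
    sum of [m] turns a small increase of the potential into a strict slack. *)
Definition steppable k (G eps del B : R) S (w : R) : Prop :=
  exists (m : Y -> R) (c : Y -> R -> R) (C : Y -> R),
   [/\ (forall y, 0 <= m y <= 1) /\ (forall y x, S x -> m y <= tent y x),
       (forall y h, 0 <= c y h) /\ (forall y, measurable_fun setT (c y)),
       forall y, (\int[lebesgue_measure]_(h in `]0%R, 1%R[) (c y h)%:E <= (C y)%:E)%E,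
       \sum_y C y <= w * \sum_y m y /\ 1 / 2 <= \sum_y m y &
       forall y h, piece k G eps del B (S `&` [set x | tent y x = h]) (c y h)].

Lemma crude_const_gt0 : 0 < K.
Proof. by rewrite /K ltr_wpDl // mulr_ge0 ?(lipschitz_const_ge0 _ om0) // mulr_ge0. Qed.

Lemma integral_indic_le (a u v : R) : 0 <= a -> u <= v ->
  (\int[lebesgue_measure]_(h in `]0%R, 1%R[)
     (a * (\1_(`[u, v]%classic : set R) h))%:E <= (a * (v - u))%:E)%E.
Proof.
move=> a0 uv; under eq_integral do rewrite EFinM.
rewrite ge0_integralZl //=; first last.
- by apply/measurable_EFinP; exact: measurable_indic.
rewrite integral_indic //= EFinM lee_wpmul2l // ?lee_fin //.
apply: (@le_trans _ _ (lebesgue_measure (`[u, v]%classic : set R))).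
  by apply: le_measure; rewrite ?inE //=; exact: measurableI.
rewrite lebesgue_measure_itv /= lte_fin; case: ifPn => // _.
by rewrite lee_fin subr_ge0.
Qed.

Lemma measurable_gauss (s mu : R) :
  measurable_fun setT (fun h : R => expR (- (lam * ((h - mu) / s) ^+ 2))).
Proof.
apply: measurableT_comp => //; apply: measurable_funN; apply: measurable_funM => //.
by apply: measurable_funX; apply: measurable_funM => //; apply: measurable_funB.
Qed.

(** Each of the [D] tents varies by at most [L * d] on [S], and they sum to one at [x1]. *)
Lemma tent_lower d S x1 : diam_le d S -> S x1 -> 0 <= d ->
  let m y := Num.max 0 (tent y x1 - L * d) in
  [/\ forall y, 0 <= m y <= 1, forall y x, S x -> m y <= tent y x &
      1 - D * L * d <= \sum_y m y].
Proof.
move=> dS Sx1 d0 m; have Ld : 0 <= L * d by rewrite mulr_ge0 // lipschitz_const_ge0.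
split.
- move=> y; rewrite /m le_max lexx ge_max ler01 /=.
  by have := tent_le1 om y x1; lra.
- move=> y x Sx; rewrite /m ge_max tent_ge0 /=.
  have := tent_lipschitz om0 y x1 x; rewrite ler_norml => /andP[_ h].
  have : L * eucl_norm (x1 - x) <= L * d by rewrite ler_wpM2l ?lipschitz_const_ge0 ?dS.
  by move: h; lra.
- have -> : 1 - D * L * d = \sum_y (tent y x1 - L * d).
    rewrite sumrB tent_sum sumr_const -[X in _ = _ - X]mulr_natl; ring.
  by apply: ler_sum => y _; rewrite /m le_max lexx orbT.
Qed.

(** Only levels within [L * d] of [tent y x1] meet [S]. This gains a factor of order [d] without any
    flatness, at the price of a bad constant. *)
Lemma crude_step k G eps del B S w d :
  diam_le d S -> 0 < d <= del -> S !=set0 -> D * L * d <= 1 / 2 ->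
  (K * d) ^+ k.+1 <= w -> steppable k G eps del B S w.
Proof.
move=> dS /andP[d0 ddel] [x1 Sx1] DL Kw; have [m01 mS ms] := tent_lower dS Sx1 (ltW d0).
have Ld : 0 <= L * d by rewrite mulr_ge0 ?(lipschitz_const_ge0 _ om0) // ltW.
have Kd : 0 <= K * d by rewrite mulr_ge0 // ltW // crude_const_gt0.
exists (fun y => Num.max 0 (tent y x1 - L * d)),
  (fun y h => (K * d) ^+ k * \1_(`[tent y x1 - L * d, tent y x1 + L * d]%classic) h),
  (fun y => (K * d) ^+ k * (2 * (L * d))); split.
- by split.
- split=> [y h|y]; first by rewrite mulr_ge0 // exprn_ge0.
  by apply: measurable_funM => //; exact: measurable_indic.
- move=> y; rewrite [X in (K * d) ^+ k * X](_ : _ = tent y x1 + L * d - (tent y x1 - L * d)); last by ring.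
  by apply: integral_indic_le; [exact: exprn_ge0|lra].
- have ms2 : 1 / 2 <= \sum_y Num.max 0 (tent y x1 - L * d) by apply: le_trans ms; lra.
  split=> //; rewrite sumr_const -[leLHS]mulr_natl.
  apply: (@le_trans _ _ ((K * d) ^+ k.+1 * (1 / 2))); last first.
    by rewrite ler_pM // ?divr_ge0 ?exprn_ge0.
  rewrite exprS; have Kk := exprn_ge0 k Kd.
  rewrite [leLHS](_ : _ = (K * d) ^+ k * (2 * (D * L * d))); last by ring.
  rewrite [leRHS](_ : _ = (K * d) ^+ k * (K * d / 2)); last by ring.
  rewrite ler_wpM2l // /K.
  rewrite [leRHS](_ : _ = 4 * (D * L * d) + d / 2); last by field.
  have : 0 <= D * L * d by rewrite -mulrA mulr_ge0.
  by move: d0; lra.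
- move=> y h; split; first by rewrite mulr_ge0 // exprn_ge0.
  rewrite indicE; case: (boolP (h \in _)) => [|hn].
    rewrite inE => hI; constructor 3; exists d; rewrite mulr1 d0 ddel; split => //.
    by move=> x x' [Sx _] [Sx' _]; exact: dS.
  constructor 1 => x [Sx /= fx]; case/negP: hn; rewrite inE /= in_itv /= -fx.
  have := tent_lipschitz om0 y x x1; rewrite ler_norml => /andP[h1 h2].
  have : L * eucl_norm (x - x1) <= L * d by rewrite ler_wpM2l ?(lipschitz_const_ge0 _ om0) ?dS.
  by move=> h3; apply/andP; split; lra.
Qed.

(** Tents are separated by the length [q y] of their gradient along the plane. For [q y >= kap] the
    slices stay flat with a Gaussian weight, which integrates to [q y * d * Num.sqrt (pi / lam)],
    and [sum_enorm_tent_grad] bounds the sum. For smaller [q y] the slices become crude pieces, but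
    the levels meeting [S] fill so short an interval that all these tents together cost at most
    [eta * d ^+ k.+1]. *)
Lemma flat_step k G G' eps eps' del' B S w (E : 'M[R]_(k.+1, N)) x0 d b e1 kap eta :
  let rho := 2 * (Num.sqrt B + 1) in
  flat_in E x0 d b eps S -> S !=set0 -> 0 < d -> b <= B -> 0 <= B -> 0 <= eps <= 1 ->
  L * eps + Q * (Num.sqrt B + 1) ^+ 2 * d <= e1 ->
  0 < kap -> e1 <= kap -> eps + e1 / kap <= eps' -> rho * (e1 / kap) <= eta ->
  0 < eta <= 1 / 2 -> d <= del' -> rho * d <= del' ->
  D * L * (rho * d) <= eta ->
  (K * rho) ^+ k * (2 * (Num.sqrt B * kap + e1)) <= eta / D ->
  0 <= G' ->
  G' * expR (lam * eta) * (2 * om * Num.sqrt k.+1%:R * Num.sqrt (pi / lam)) + eta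
    <= G * (1 - eta) ->
  G * expR (lam * b) * d ^+ k.+1 <= w ->
  steppable k G' eps' del' (B + 1) S w.
Proof.
move=> rho fl [x1 Sx1] d0 bB B0 e01 he1 kap0 e1k heps heta /andP[eta0 eta1] dd rd DL crd G'0 GG Gw.
have dS : diam_le (rho * d) S by apply: flat_in_diam fl d0 bB B0 _; case/andP: e01.
have rho0 : 0 < rho by rewrite mulr_gt0 // ltr_wpDl // sqrtr_ge0.
have rd0 : 0 < rho * d by rewrite mulr_gt0.
have [m01 mS ms] := tent_lower dS Sx1 (ltW rd0).
have L0 := lipschitz_const_ge0 N om0; have D0 := card_sign_gt0 R N.
have e10 : 0 <= e1.
  apply: le_trans he1; apply: addr_ge0; first by rewrite mulr_ge0 //; case/andP: e01.
  by rewrite !mulr_ge0 ?sqr_ge0 ?(taylor_const_ge0 N om) // ltW.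
(* A nonempty flat set has [b >= 0]; then [expR (lam * b) >= 1], and the additive error [eta] can be
   absorbed into the weight. *)
have b0 : 0 <= b.
  have [a [ab _]] := fl.2 _ Sx1; rewrite -(pmulr_lge0 _ (exprn_gt0 2 d0)).
  exact: le_trans (dotvv_ge0 a) ab.
pose q y := eucl_norm (tent_grad y x0 *m E^T).
have q0 y : 0 <= q y by exact: enorm_ge0.
pose W := (Num.sqrt B * kap + e1) * d.
have W0 : 0 <= W.
  apply: mulr_ge0 (ltW d0); apply: addr_ge0 => //.
  by apply: mulr_ge0 (sqrtr_ge0 _) (ltW kap0).
have Kr0 : 0 <= K * (rho * d) by rewrite mulr_ge0 ?ltW // crude_const_gt0.
pose m y := Num.max 0 (tent y x1 - L * (rho * d)).
pose c y h := if kap <= q y then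
    G' * expR (lam * (b + eta)) * d ^+ k *
      expR (- (lam * ((h - tent y x0) / (q y * d)) ^+ 2))
  else (K * (rho * d)) ^+ k * \1_(`[tent y x0 - W, tent y x0 + W]%classic) h.
pose C y := G' * expR (lam * (b + eta)) * d ^+ k * (q y * d * Num.sqrt (pi / lam)) +
  eta / D * d ^+ k.+1.
have F0 : 0 <= G' * expR (lam * (b + eta)) * d ^+ k.
  by rewrite !mulr_ge0 ?expR_ge0 // exprn_ge0 // ltW.
exists m, c, C; split.
- by split.
- split=> [y h|y]; rewrite /c; case: (kap <= q y).
  + by rewrite mulr_ge0 ?expR_ge0.
  + by rewrite mulr_ge0 ?exprn_ge0.
  + by apply: measurable_funM => //; exact: measurable_gauss.
  + by apply: measurable_funM => //; exact: measurable_indic.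
- move=> y; rewrite /c /C; case: (boolP (kap <= q y)) => hq.
    have qy : 0 < q y by exact: (lt_le_trans kap0 hq).
    under eq_integral do rewrite EFinM.
    rewrite ge0_integralZl //=; last first.
      by apply/measurable_EFinP; apply: measurable_funTS; exact: measurable_gauss.
    apply: le_trans (lee_wpmul2l _ (gauss_integral_le lam0 _ (mulr_gt0 qy d0))) _.
      by rewrite lee_fin.
    rewrite -EFinM lee_fin lerDl; apply: mulr_ge0; last by rewrite exprn_ge0 // ltW.
    by rewrite divr_ge0 ?ltW.
  apply: le_trans (integral_indic_le _ _) _; [exact: exprn_ge0|lra|].
  rewrite lee_fin; apply: ler_wpDl.
    by rewrite !mulr_ge0 ?sqrtr_ge0 ?expR_ge0 ?exprn_ge0 // ltW.
  have -> : (K * (rho * d)) ^+ k * (tent y x0 + W - (tent y x0 - W)) =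
     (K * rho) ^+ k * (2 * (Num.sqrt B * kap + e1)) * d ^+ k.+1.
    by rewrite mulrA exprMn /W exprS; ring.
  by rewrite ler_wpM2r // exprn_ge0 // ltW.
- have ms1 : 1 - eta <= \sum_y m y by apply: le_trans ms; lra.
  split; last by apply: le_trans ms1; lra.
  have Sq := sum_enorm_tent_grad om0 x0 fl.1.
  rewrite /C big_split /= -mulr_sumr -2!mulr_suml sumr_const -[X in _ + X <= _]mulr_natl.
  have -> : D * (eta / D * d ^+ k.+1) = eta * d ^+ k.+1 by field; rewrite gt_eqF.
  have eb : 1 <= expR (lam * b) by rewrite -expR0 ler_expR mulr_ge0 // ltW.
  have dk : 0 <= d ^+ k.+1 by rewrite exprn_ge0 // ltW.
  apply: (@le_trans _ _ (G * expR (lam * b) * d ^+ k.+1 * (1 - eta))); last first.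
    have w0 : 0 <= G * expR (lam * b) * d ^+ k.+1.
      rewrite !mulr_ge0 ?expR_ge0 //.
      have h1 : 0 < 1 - eta by move: eta1; lra.
      rewrite -(pmulr_lge0 _ h1); apply: le_trans GG.
      by rewrite addr_ge0 ?mulr_ge0 ?expR_ge0 ?sqrtr_ge0 // ltW.
    have h1 : 0 <= 1 - eta by move: eta1; lra.
    by rewrite ler_pM.
  apply: (@le_trans _ _ (d ^+ k.+1 * expR (lam * b) *
     (G' * expR (lam * eta) * (2 * om * Num.sqrt k.+1%:R * Num.sqrt (pi / lam)) + eta))); last first.
    rewrite [leRHS](_ : _ = d ^+ k.+1 * expR (lam * b) * (G * (1 - eta))); last by ring.
    by rewrite ler_wpM2l // mulr_ge0 ?expR_ge0.
  rewrite [leRHS]mulrDr lerD //; last first.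
    rewrite [leRHS](_ : _ = (eta * d ^+ k.+1) * expR (lam * b)); last by ring.
    by rewrite ler_peMr // mulr_ge0 // ltW.
  rewrite mulrDr expRD exprS.
  rewrite [leRHS](_ : _ = (G' * (expR (lam * b) * expR (lam * eta)) * d ^+ k * d *
     Num.sqrt (pi / lam)) * (2 * om * Num.sqrt k.+1%:R)); last by ring.
  rewrite [leLHS](_ : _ = (G' * (expR (lam * b) * expR (lam * eta)) * d ^+ k * d *
     Num.sqrt (pi / lam)) * \sum_y q y); last by ring.
  have d0' := ltW d0.
  by rewrite ler_wpM2l // !mulr_ge0 ?expR_ge0 ?exprn_ge0 ?sqrtr_ge0.
- move=> y h; rewrite /c; case: ifPn => hq.
    have qy : 0 < q y by exact: (lt_le_trans kap0 hq).
    split; first by rewrite mulr_ge0 ?expR_ge0.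
    have eqk : e1 / q y <= e1 / kap.
      by rewrite ler_wpM2l // lef_pV2 // posrE.
    have [x2 [E' fl']] := flat_slice (eps' := eps') (eta := eta) om0 h fl d0 bB B0 e01 he1 qy
      (le_trans e1k hq) (le_trans (lerD (lexx _) eqk) heps)
      (le_trans (ler_wpM2l (ltW rho0) eqk) heta).
    (* The loss of squared radius turns into the Gaussian factor of [c], so the weight is attained
       with equality. *)
    constructor 2; exists E', x2, d; eexists; split; [exact: fl'| | |].
    + by rewrite d0 dd.
    + by have := sqr_ge0 ((h - tent y x0) / (q y * d)); move: bB eta1; rewrite -/q; lra.
    + rewrite mulrBr expRD -/q le_eqVlt; apply/orP; left; apply/eqP.
      by ring.
  split; first by rewrite mulr_ge0 ?exprn_ge0.
  rewrite indicE; case: (boolP (h \in _)) => [|hn].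
    rewrite inE => hI; constructor 3; exists (rho * d); rewrite mulr1 rd0 rd; split => //.
    by move=> x x' [Sx _] [Sx' _]; exact: dS.
  constructor 1 => x [Sx /= fx]; case/negP: hn; rewrite inE /= in_itv /= -fx.
  have [a [ab _]] := flat_lin om0 y fl d0 bB B0 e01 Sx.
  rewrite ler_norml => /andP[h1 h2].
  have aB : eucl_norm a <= Num.sqrt B * d.
    rewrite enorm_leP; last by rewrite mulr_ge0 ?sqrtr_ge0 // ltW.
    by rewrite exprMn sqr_sqrtr // (le_trans ab) // ler_wpM2r // sqr_ge0.
  have : `|dotv a (tent_grad y x0 *m E^T)| <= Num.sqrt B * d * kap.
    apply: le_trans (dotv_CS _ _) _; rewrite ler_pM ?enorm_ge0 //.
    by rewrite ltW // ltNge.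
  rewrite ler_norml => /andP[h3 h4].
  have h5 : (L * eps + Q * (Num.sqrt B + 1) ^+ 2 * d) * d <= e1 * d by rewrite ler_wpM2r // ltW.
  have WE : W = Num.sqrt B * d * kap + e1 * d by rewrite /W; ring.
  by apply/andP; split; rewrite WE; lra.
Qed.

End Steps.

(** * Foams avoiding a set *)

Section Induction.
Variables (R : realType) (N : nat) (om lam : R).
Hypotheses (om0 : 0 < om) (lam0 : 0 < lam).
Local Notation Y := {ffun 'I_N -> bool}.
Local Notation X := 'rV[R]_N.
Local Notation tent := (@tent R N om).
Local Notation L := (2 * om * N%:R).
Local Notation Q := (om ^+ 2 * (2 + 3 * N%:R ^+ 2)).
Local Notation D := (#|{: Y}|%:R : R).
Local Notation K := (8 * D * L + 1).
Local Notation piece := (@piece R N om lam).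
Local Notation steppable := (@steppable R N om lam).

(** Serves to choose a parameter subject to finitely many linear smallness conditions. *)
Lemma small_enough (s : seq (R * R)) :
  (forall p, p \in s -> 0 <= p.1 /\ 0 < p.2) ->
  exists2 x, 0 < x & forall p, p \in s -> p.1 * x <= p.2.
Proof.
elim: s => [|[a b] s IH] hs; first by exists 1.
have [|x x0 hx] := IH; first by move=> p ps; apply: hs; rewrite inE ps orbT.
have [a0 b0] := hs (a, b) (mem_head _ _).
have a1 : 0 < a + 1 by rewrite ltr_wpDl.
exists (Num.min x (b / (a + 1))); first by rewrite lt_min x0 divr_gt0.
have m0 : 0 <= Num.min x (b / (a + 1)) by rewrite le_min (ltW x0) divr_ge0 // ltW.
move=> p; rewrite inE => /predU1P[->/=|ps].
  apply: (@le_trans _ _ ((a + 1) * (b / (a + 1)))).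
    by rewrite ler_pM // ?lerDl // ge_min lexx orbT.
  by rewrite mulrC divfK // gt_eqF.
have [|p0 _] := hs p; first by rewrite inE ps orbT.
by apply: le_trans (hx p ps); rewrite ler_wpM2l // ge_min lexx.
Qed.

(** Cost of [k] successive slicings: in dimension [m.+1] the gradients contribute
    [2 * om * Num.sqrt m.+1%:R] and the Gaussian integral [Num.sqrt (pi / lam)]. *)
Definition foam_const k : R :=
  \prod_(m < k) (2 * om * Num.sqrt m.+1%:R * Num.sqrt (pi / lam)).

Lemma foam_const_ge0 k : 0 <= foam_const k.
Proof. by apply: prodr_ge0 => m _; rewrite !mulr_ge0 ?sqrtr_ge0 // ltW. Qed.

Lemma exp_margin (a G : R) : 0 <= a -> a < G ->
  exists2 eta, 0 < eta <= 1 / 2 & a * expR (lam * eta) + eta <= G * (1 - eta).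
Proof.
move=> a0 aG; have G0 : 0 < G by exact: le_lt_trans aG.
have [|x x0 hx] := @small_enough [:: (1, 1 / 2); (lam, 1 / 2); (2 * lam * a + 1 + G, G - a)].
  move=> p; rewrite !inE => /or3P[] /eqP -> /=; split; rewrite ?divr_gt0 ?subr_gt0 ?(ltW lam0) //.
  by rewrite !addr_ge0 ?mulr_ge0 // ltW.
have h1 := hx _ (mem_head _ _); rewrite /= mul1r in h1.
have h2 : lam * x <= 1 / 2 by apply: (hx (lam, 1 / 2)); rewrite !inE eqxx orbT.
have h3 : (2 * lam * a + 1 + G) * x <= G - a.
  by apply: (hx (2 * lam * a + 1 + G, G - a)); rewrite !inE eqxx !orbT.
exists x; first by rewrite x0.
set t := lam * x in h2 *.
have t0 : 0 <= t by rewrite mulr_ge0 // ltW.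
(* From [expR (- t) >= 1 - t], using [t <= 1 / 2]. *)
have et : expR t <= 1 + 2 * t.
  have e1 := expR_ge1Dx (- t).
  have : expR t * expR (- t) = 1 by rewrite -expRD subrr expR0.
  have : expR t * (1 - t) <= expR t * expR (- t) by rewrite ler_wpM2l ?expR_ge0.
  move=> /[swap] -> h4; have h5 : 0 < 1 - t by lra.
  rewrite -(ler_pM2r h5) (le_trans h4) //.
  have : 0 <= t * (1 - 2 * t) by rewrite mulr_ge0 //; lra.
  by lra.
have : a * expR t <= a * (1 + 2 * t) by rewrite ler_wpM2l.
by move: h3; rewrite /t; lra.
Qed.

(** The constants of [flat_step] are chosen in the order [eta], [kap], [r = e1 / kap], [eps], [del]:
    first the margin in [G], then the gradient threshold, then the linearisation error, and last the
    flatness and scale that achieve it. *)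
Lemma piece_steppable k B G G' eps' del' :
  0 <= B -> 0 <= G' -> 0 < eps' -> 0 < del' ->
  G' * (2 * om * Num.sqrt k.+1%:R * Num.sqrt (pi / lam)) < G ->
  exists eps del, [/\ 0 < eps, 0 < del & forall S w,
    piece k.+1 G eps del B S w -> steppable k G' eps' del' (B + 1) S w].
Proof.
move=> B0 G'0 eps'0 del'0; set A := 2 * om * _ * _ => GA.
have A0 : 0 <= A by rewrite !mulr_ge0 ?sqrtr_ge0 // ltW.
have [eta /andP[eta0 eta1] heta] := exp_margin (mulr_ge0 G'0 A0) GA.
pose rho := 2 * (Num.sqrt B + 1).
have sB := sqrtr_ge0 B.
have rho0 : 0 < rho by rewrite mulr_gt0 // ltr_wpDl.
have D0 : 0 < D := card_sign_gt0 R N; have L0 : 0 <= L := lipschitz_const_ge0 N om0; have Q0 : 0 <= Q := taylor_const_ge0 N om.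
have K0 : 0 < K := crude_const_gt0 N om0.
(* As [e1 <= kap], the length [2 * (Num.sqrt B * kap + e1)] is at most [rho * kap]. *)
have [|kap kap0 hkap] := @small_enough [:: ((K * rho) ^+ k * rho, eta / D)].
  move=> p; rewrite inE => /eqP -> /=; split; last by rewrite divr_gt0.
  by rewrite mulr_ge0 ?exprn_ge0 ?mulr_ge0 // ltW.
have {}hkap := hkap _ (mem_head _ _); rewrite /= in hkap.
have [|r r0 hr] := @small_enough [:: (1, 1); (1, eps' / 2); (rho, eta)].
  by move=> p; rewrite !inE => /or3P[] /eqP -> /=; split; rewrite ?divr_gt0 // ltW.
have r1 : r <= 1 by have := hr _ (mem_head _ _); rewrite /= mul1r.
have r2 : r <= eps' / 2.
  by have := hr (1, eps' / 2); rewrite /= mul1r; apply; rewrite !inE eqxx orbT.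
have r3 : rho * r <= eta by apply: (hr (rho, eta)); rewrite !inE eqxx !orbT.
pose e1 := kap * r; have e10 : 0 < e1 by rewrite mulr_gt0.
have e1k : e1 / kap = r by rewrite /e1 mulrC mulKf // gt_eqF.
have [|eps eps0 heps] := @small_enough [:: (1, 1); (1, eps' / 2); (L, e1 / 2)].
  by move=> p; rewrite !inE => /or3P[] /eqP -> /=; split; rewrite ?divr_gt0.
have p1 : eps <= 1 by have := heps _ (mem_head _ _); rewrite /= mul1r.
have p2 : eps <= eps' / 2.
  by have := heps (1, eps' / 2); rewrite /= mul1r; apply; rewrite !inE eqxx orbT.
have p3 : L * eps <= e1 / 2 by apply: (heps (L, e1 / 2)); rewrite !inE eqxx !orbT.
have [|del del0 hdel] := @small_enough [:: (1, del'); (rho, del');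
    (Q * (Num.sqrt B + 1) ^+ 2, e1 / 2); (D * L * rho, eta); (D * L, 1 / 2)].
  move=> p; rewrite !inE => /orP[|/or4P[]] /eqP -> /=; split;
   by rewrite ?divr_gt0 ?mulr_ge0 ?sqr_ge0 // ?ltW.
have d1 : del <= del' by have := hdel _ (mem_head _ _); rewrite /= mul1r.
have d2 : rho * del <= del' by apply: (hdel (rho, del')); rewrite !inE eqxx !orbT.
have d3 : Q * (Num.sqrt B + 1) ^+ 2 * del <= e1 / 2.
  by apply: (hdel (Q * (Num.sqrt B + 1) ^+ 2, e1 / 2)); rewrite !inE eqxx !orbT.
have d4 : D * L * rho * del <= eta.
  by apply: (hdel (D * L * rho, eta)); rewrite !inE eqxx !orbT.
have d5 : D * L * del <= 1 / 2.
  by apply: (hdel (D * L, 1 / 2)); rewrite !inE eqxx !orbT.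
exists eps, del; split => // S w [w0 hS].
have [S0|S0] := pselect (S !=set0); last first.
  exists (fun=> 1), (fun _ _ => 0), (fun=> 0); split.
  - split=> [y|y x Sx]; first by rewrite ler01 lexx.
    by case: S0; exists x.
  - by split=> // y; exact: measurable_cst.
  - by move=> y; rewrite integral0.
  - split; first by rewrite big1 // mulr_ge0 // sumr_ge0.
    rewrite sumr_const; apply: (@le_trans _ _ 1); first by lra.
    by rewrite ler1n; apply/card_gt0P; exists [ffun=> true].
  - move=> y h; split => //; constructor 1 => x [Sx _].
    by case: S0; exists x.
case: hS => [hn|[E [x0 [d [b [fl /andP[d0 dd] bB hw]]]]]|[d [dS /andP[d0 dd] hw]]].
- by case: S0 => x /hn.
- apply: (flat_step (G := G) om0 lam0 (kap := kap) (e1 := e1) (eta := eta) fl S0 d0 bB B0 _ _ kap0).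
  + by rewrite p1 ltW.
  + have : Q * (Num.sqrt B + 1) ^+ 2 * d <= e1 / 2.
      by apply: le_trans d3; rewrite ler_wpM2l // mulr_ge0 // sqr_ge0.
    by move: p3; lra.
  + by rewrite /e1 ler_piMr // ltW.
  + by rewrite e1k; lra.
  + by rewrite e1k.
  + by rewrite eta0 eta1.
  + exact: le_trans dd d1.
  + by apply: le_trans d2; rewrite ler_wpM2l // ltW.
  + rewrite [D * L * _]mulrA; apply: le_trans d4; rewrite ler_wpM2l //.
    by apply: mulr_ge0 (ltW rho0); apply: mulr_ge0 L0; exact: ltW.
  + apply: le_trans hkap; rewrite -[leRHS]mulrA ler_wpM2l //.
      by rewrite exprn_ge0 // mulr_ge0 // ltW.
    rewrite [leRHS](_ : _ = 2 * (Num.sqrt B * kap + kap)); last by rewrite /rho; ring.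
    by rewrite ler_wpM2l // lerD2l /e1 ler_piMr // ltW.
  + by [].
  + by rewrite -/A [G' * _ * A]mulrAC.
  + exact: hw.
- apply: (crude_step lam om0 G' eps' (B + 1) dS _ S0 _ hw).
  + by rewrite d0 (le_trans dd d1).
  + by apply: le_trans d5; rewrite ler_wpM2l // mulr_ge0 // ltW.
Qed.

(** Induction on [k]. A greedy foam cuts the pieces into slices of one dimension less whose weights
    still sum to less than one, and every point outside its cells lies on such a slice. In dimension
    zero a nonempty piece has weight at least one, so none is left. *)
Lemma foams_cover k B G : 0 <= B -> foam_const k < G ->
  exists eps del, [/\ 0 < eps, 0 < del &
   forall (I : finType) (S : I -> set X) (w : I -> R),
     (forall i, piece k G eps del B (S i) (w i)) -> \sum_i w i < 1 ->
   exists Fs : seq (seq (Y * R)), [/\ size Fs = k,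
     forall F, F \in Fs -> levels_in01 F &
     forall i x, S i x -> exists2 F, F \in Fs & in_cell tent F x]].
Proof.
elim: k B G => [|k IH] B G B0 hG.
  exists 1, 1; split => // I S w hp w1.
  exists [::]; split => // i x Six; exfalso.
  have wi : w i < 1.
    by apply: le_lt_trans w1; rewrite (bigD1 i) //= lerDl sumr_ge0 // => j _; case: (hp j).
  rewrite /foam_const big_ord0 in hG.
  case: (hp i) => w0 [hn|[E [x0 [d [b [[_ fl] /andP[d0 dd] bB hw]]]]]|[d [dS dd]]].
  - exact: hn Six.
  - have [a [ab _]] := fl _ Six.
    have b0 : 0 <= b.
      by rewrite -(pmulr_lge0 _ (exprn_gt0 2 d0)); exact: le_trans (dotvv_ge0 a) ab.
    have : 1 <= expR (lam * b) by rewrite -expR0 ler_expR mulr_ge0 // ltW.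
    move: hw; rewrite expr0 mulr1 => hw h1.
    have G0 : 0 <= G by rewrite ltW // (lt_trans _ hG).
    have : 1 < G * expR (lam * b) by apply: (lt_le_trans hG); rewrite ler_peMr.
    by rewrite ltNge (le_trans hw (ltW wi)).
  - by rewrite expr0 leNgt wi.
set A := 2 * om * Num.sqrt k.+1%:R * Num.sqrt (pi / lam).
have A0 : 0 < A by rewrite /A !mulr_gt0 ?sqrtr_gt0 ?divr_gt0 ?pi_gt0.
rewrite /foam_const big_ord_recr /= -/(foam_const k) -/A in hG.
(* The midpoint leaves strict inequalities both for the induction hypothesis and for the step. *)
pose G' := (foam_const k + G / A) / 2.
have lt1 : foam_const k < G / A by rewrite ltr_pdivlMr.
have G'1 : foam_const k < G' by rewrite /G'; lra.
have G'2 : G' * A < G by rewrite -ltr_pdivlMr // /G'; lra.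
have G'0 : 0 <= G' by rewrite (le_trans (foam_const_ge0 k)) // ltW.
have [eps' [del' [eps'0 del'0 {}IH]]] := IH (B + 1) G' (addr_ge0 B0 ler01) G'1.
have [eps [del [eps0 del0 st]]] := piece_steppable B0 G'0 eps'0 del'0 G'2.
exists eps, del; split => // I S w hp w1.
have hst i : exists mcC : (Y -> R) * (Y -> R -> R) * (Y -> R),
   [/\ (forall y, 0 <= mcC.1.1 y <= 1) /\ (forall y x, S i x -> mcC.1.1 y <= tent y x),
       (forall y h, 0 <= mcC.1.2 y h) /\ (forall y, measurable_fun setT (mcC.1.2 y)),
       forall y, (\int[lebesgue_measure]_(h in `]0%R, 1%R[) (mcC.1.2 y h)%:E <= (mcC.2 y)%:E)%E,
       \sum_y mcC.2 y <= w i * \sum_y mcC.1.1 y /\ 1 / 2 <= \sum_y mcC.1.1 y &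
       forall y h, piece k G' eps' del' (B + 1) (S i `&` [set x | tent y x = h]) (mcC.1.2 y h)].
  by have [m [c [C hh]]] := st _ _ (hp i); exists (m, c, C).
have [mcC hmcC] := choice hst.
pose m i := (mcC i).1.1; pose c i := (mcC i).1.2; pose C i := (mcC i).2.
(* Raising every potential by [tau] uses less than the gap below one, and provides the slack
   [tau / 2] since the [m i y] sum to at least [1 / 2] over [y]. *)
pose tau := (1 - \sum_i w i) / (2 * (#|I|%:R + 1)).
have I0 : 0 < #|I|%:R + 1 :> R by rewrite ltr_wpDl.
have tau0 : 0 < tau by rewrite divr_gt0 ?subr_gt0 // mulr_gt0.
have [F [F01 Fk Fc]] : exists F, [/\ levels_in01 F, forall i, killed m i F &
    \sum_i \sum_(p <- cuts m i F) c i p.1 p.2 <= \sum_i (w i + tau)].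
  apply: (@foam_greedy R _ I m c C (fun i => w i + tau) (tau / 2)).
  - by rewrite divr_gt0.
  - by apply/card_gt0P; exists [ffun=> true].
  - by move=> i y; case: (hmcC i) => -[h _] _ _ _ _; exact: h.
  - by move=> i; rewrite addr_ge0 ?(ltW tau0) //; case: (hp i).
  - by move=> i y h; case: (hmcC i) => _ [h1 _] _ _ _; exact: h1.
  - by move=> i y; case: (hmcC i) => _ [_ h1] _ _ _; exact: h1.
  - by move=> i y; case: (hmcC i) => _ _ h1 _ _; exact: h1.
  - move=> i; case: (hmcC i) => _ _ _ [h1 h2] _; rewrite mulrDl lerD //.
    by rewrite ler_wpM2l ?(ltW tau0) //; lra.
(* The slices are indexed by a piece together with a position in its list of cuts. *)
pose J := {i : I & 'I_(size (cuts m i F))}.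
pose dp (j : J) := tnth (in_tuple (cuts m (tag j) F)) (tagged j).
pose S' (j : J) := S (tag j) `&` [set x | tent (dp j).1 x = (dp j).2].
pose w' (j : J) := c (tag j) (dp j).1 (dp j).2.
have [||Fs [sF lF cF]] := IH J S' w'.
- by move=> j; case: (hmcC (tag j)) => _ _ _ _; exact.
- have -> : \sum_j w' j = \sum_i \sum_(p <- cuts m i F) c i p.1 p.2.
    under [RHS]eq_bigr do rewrite big_tnth.
    by rewrite sig_big_dep.
  apply: le_lt_trans Fc _; rewrite big_split /= sumr_const -[X in _ + X]mulr_natr.
  have : tau * (#|I|%:R + 1) = (1 - \sum_i w i) / 2 by rewrite /tau; field; rewrite gt_eqF.
  by rewrite mulrDr mulr1; lra.
exists (F :: Fs); split => /=; first by rewrite sF.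
  by move=> F'; rewrite inE => /predU1P[->|/lF].
move=> i x Six.
have mf y : m i y <= tent y x by case: (hmcC i) => -[_ h] _ _ _ _; exact: h.
have [xF|[p pF fp]] := foam_cover mf (Fk i); first by exists F; rewrite ?inE ?eqxx.
have [l lE] : exists l, p = tnth (in_tuple (cuts m i F)) l by apply/tnthP.
have [|F' F'F xF'] := cF (Tagged (fun i => 'I_(size (cuts m i F))) l) x.
  by split => //=; rewrite /dp /= -lE.
by exists F' => //; rewrite inE F'F orbT.
Qed.

End Induction.

(** * From foams to a width bound *)

Section NormTopology.
Variables (R : realType) (N : nat).
Local Notation X := 'rV[R]_N.

Lemma coord_le_norm (x : X) i : `|x 0 i| <= `|x|.
Proof.
by rewrite [leRHS]mx_normrE; exact: (le_bigmax _ (fun ij => `|x ij.1 ij.2|) (0, i)).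
Qed.

Lemma enorm_le_norm (x : X) : eucl_norm x <= N%:R * `|x|.
Proof.
apply: le_trans (enorm_le_sum x) _.
apply: (@le_trans _ _ (\sum_(i < N) `|x|)); first by apply: ler_sum => i _; exact: coord_le_norm.
by rewrite sumr_const card_ord mulr_natl.
Qed.

Lemma enorm_small (x0 : X) (e : R) : 0 < e -> \forall x \near x0, eucl_norm (x - x0) < e.
Proof.
move=> e0; have N0 : 0 < N%:R + 1 :> R by rewrite ltr_wpDl.
near=> x; apply: le_lt_trans (enorm_le_norm _) _.
apply: (@le_lt_trans _ _ ((N%:R + 1) * `|x - x0|)); first by rewrite ler_wpM2r // lerDl.
rewrite mulrC -ltr_pdivlMr // distrC; near: x.
apply: (cvgr_dist_lt id x0); last by rewrite divr_gt0.
exact: cvg_id.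
Unshelve. all: by end_near. Qed.

Lemma lipschitz_continuous (f : X -> R) (C : R) :
  (forall x x', `|f x - f x'| <= C * eucl_norm (x - x')) -> continuous f.
Proof.
move=> hf x0; apply/(@cvgrPdist_lt _ _ _ (nbhs x0)) => e e0.
have C0 : 0 < `|C| + 1 by rewrite ltr_wpDl.
have := enorm_small x0 (divr_gt0 e0 C0); apply: filterS => x hx.
rewrite distrC; apply: le_lt_trans (hf x x0) _.
apply: (@le_lt_trans _ _ ((`|C| + 1) * eucl_norm (x - x0))).
  by rewrite ler_wpM2r ?enorm_ge0 // (le_trans (ler_norm C)) // lerDl.
by rewrite mulrC -ltr_pdivlMr.
Qed.

Lemma linf_norm_le (x : X) a : 0 <= a -> (forall i, `|x 0 i| <= a) -> linf_norm x <= a.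
Proof. by move=> a0 h; apply: bigmax_le. Qed.

End NormTopology.

(** * The map to weighted means of cube centres *)

Section WidthBound.
Variables (R : realType) (N : nat) (s : R).
Hypothesis s0 : 0 < s.
Local Notation om := (pi / s).
Local Notation Y := {ffun 'I_N -> bool}.
Local Notation X := 'rV[R]_N.
Local Notation tent := (@tent R N om).

Lemma om_gt0 : 0 < om. Proof. by rewrite divr_gt0 // pi_gt0. Qed.

Lemma tent_continuous (y : Y) : continuous (tent y).
Proof. exact: lipschitz_continuous (tent_lipschitz om_gt0 y). Qed.

Lemma sin_int_pi (z : int) : sin (z%:~R * pi : R) = 0.
Proof.
have h (n : nat) : sin (n%:R * pi : R) = 0.
  elim: n => [|n IH]; first by rewrite mul0r sin0.
  by rewrite -natr1 mulrDl mul1r sinDpi IH oppr0.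
case: z => n; first exact: h.
by rewrite NegzE mulrNz mulNr sinN -pmulrn h oppr0.
Qed.

(** A cosine is a sine shifted by half a cube; after the shift both vanish at the integers. *)
Definition phase (b : bool) : R := if b then 0 else 1 / 2.

Lemma trig_phase b (t : R) : trig b (om * t) = sin ((t / s + phase b) * pi).
Proof.
have s1 : s != 0 by rewrite gt_eqF.
case: b; rewrite /trig /phase.
  by congr sin; field.
by rewrite -sinDpihalf; congr sin; field.
Qed.

(** The zeros of [tent y] cut space into cubes of side [s]; this is the centre of the one that
    contains [x], the floor choosing a side on the walls. *)
Definition cube_centre (y : Y) (x : X) : X :=
  \row_i (s * ((Num.floor (x 0 i / s + phase (y i)))%:~R + 1 / 2 - phase (y i))).

Lemma cube_centre_dist (y : Y) (x : X) i : `|x 0 i - cube_centre y x 0 i| <= s / 2.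
Proof.
rewrite mxE; set t := x 0 i / s + _.
have /andP[h1 h2] := floor_itv t.
have -> : x 0 i - s * ((Num.floor t)%:~R + 1 / 2 - phase (y i)) =
  s * (t - (Num.floor t)%:~R - 1 / 2) by rewrite /t; field; rewrite gt_eqF.
rewrite normrM gtr0_norm // ler_wpM2l ?(ltW s0) // ler_norml.
move: h1 h2; rewrite intrD; move: (Num.floor t) => z h1 h2.
by apply/andP; split; lra.
Qed.

Lemma floor_near (t : R) : t != (Num.floor t)%:~R ->
  \forall u \near t, Num.floor u = Num.floor t.
Proof.
move=> tz; have /andP[h1 h2] := floor_itv t.
have h3 : (Num.floor t)%:~R < t by rewrite lt_neqAle eq_sym tz.
near=> u; apply: floor_def; apply/andP; split.
  by near: u; exact: lt_le_nbhsr.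
by near: u; exact: lt_nbhsl.
Unshelve. all: by end_near. Qed.

(** The floors jump only where their argument is an integer, and there the corresponding factor of
    [tent y] vanishes. *)
Lemma cube_centre_near (y : Y) (x : X) : 0 < tent y x ->
  \forall x' \near x, cube_centre y x' = cube_centre y x.
Proof.
move=> fx.
have tz i : x 0 i / s + phase (y i) != (Num.floor (x 0 i / s + phase (y i)))%:~R.
  apply: contraTneq fx => h; rewrite -leNgt /tent /trigprod (bigD1 i) //=.
  by rewrite trig_phase h sin_int_pi mul0r expr0n.
have : \forall x' \near x, forall i, Num.floor ((x' : X) 0 i / s + phase (y i)) =
   Num.floor (x 0 i / s + phase (y i)).
  apply: (@filter_forall _ _ (fun i (x' : X) => Num.floor (x' 0 i / s + phase (y i)) =
     Num.floor (x 0 i / s + phase (y i))) (nbhs x)) => i; have := floor_near (tz i).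
  have cont : continuous (fun x' : X => x' 0 i / s + phase (y i)).
    apply: (@lipschitz_continuous _ _ _ s^-1) => u v.
    rewrite [X in `|X|](_ : _ = s^-1 * (u - v) 0 i); last by rewrite !mxE; ring.
    by rewrite normrM gtr0_norm ?invr_gt0 // ler_wpM2l ?coord_le_enorm // invr_ge0 ltW.
  by move=> /(cont x).
apply: filterS => x' hx'; apply/rowP => i; by rewrite !mxE hx'.
Qed.

(** [t + |t|] is twice the positive part of [t]. The first term lives in the interior of the
    droplet, and the factor before the recursive call outside the closed droplet. *)
Fixpoint foam_weight (F : seq (Y * R)) (x : X) : R :=
  if F is (y, h) :: F' then
    (tent y x - h + `|tent y x - h|) + (h - tent y x + `|h - tent y x|) * foam_weight F' x
  else 0.

Fixpoint foam_moment (F : seq (Y * R)) (x : X) : X :=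
  if F is (y, h) :: F' then
    (tent y x - h + `|tent y x - h|) *: cube_centre y x +
    (h - tent y x + `|h - tent y x|) *: foam_moment F' x
  else 0.

Lemma pospart_ge0 (t : R) : 0 <= t + `|t|.
Proof. by rewrite -lerBlDl sub0r -normrN ler_norm. Qed.

Lemma foam_weight_ge0 F x : 0 <= foam_weight F x.
Proof. by elim: F => [|[y h] F IH] //=; rewrite addr_ge0 ?mulr_ge0 ?pospart_ge0. Qed.

Lemma foam_weight_gt0 F x : in_cell tent F x -> 0 < foam_weight F x.
Proof.
elim: F => [|[y h] F IH] //= [hf|[fh /IH w0]].
  apply: ltr_pwDl; last by rewrite mulr_ge0 ?pospart_ge0 ?foam_weight_ge0.
  by rewrite ltr_pwDl // subr_gt0.
apply: ltr_wpDl; first exact: pospart_ge0.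
by rewrite mulr_gt0 // ltr_pwDl // subr_gt0.
Qed.

(** At each [x] one of the two positive parts vanishes, so the whole weight of a foam sits on a
    single cube. *)
Lemma foam_moment_centre F x : exists y,
  foam_moment F x = foam_weight F x *: cube_centre y x.
Proof.
elim: F => [|[y h] F [y' IH]] /=; first by exists [ffun=> true]; rewrite scale0r.
have [fh|hf] := leP (tent y x) h.
  exists y'; rewrite [`|tent y x - h|]ler0_norm ?subr_le0 // opprB addrA subrK subrr.
  by rewrite scale0r !add0r IH scalerA.
exists y; rewrite [`|h - tent y x|]ler0_norm ?subr_le0 ?(ltW hf) // opprB addrA subrK subrr.
by rewrite scale0r mul0r !addr0.
Qed.

Lemma pospart_continuous (f : X -> R) x : {for x, continuous f} ->
  {for x, continuous (fun z => f z + `|f z|)}.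
Proof. by move=> cf; exact: (@cvgD _ _ _ (nbhs x) _ _ _ _ _ cf (cvg_norm cf)). Qed.

Lemma tentB_continuous y h x : {for x, continuous (fun z => tent y z - h)}.
Proof. exact: (@cvgB _ _ _ (nbhs x) _ _ _ _ _ (@tent_continuous y x) (cvg_cst _)). Qed.

Lemma Btent_continuous y h x : {for x, continuous (fun z => h - tent y z)}.
Proof. exact: (@cvgB _ _ _ (nbhs x) _ _ _ _ _ (cvg_cst _) (@tent_continuous y x)). Qed.

Lemma foam_weight_continuous F : continuous (foam_weight F).
Proof.
elim: F => [|[y h] F IH] x /=; first exact: cst_continuous.
have c1 := pospart_continuous (@tentB_continuous y h x).
have c2 := pospart_continuous (@Btent_continuous y h x).
exact: (@cvgD _ _ _ (nbhs x) _ _ _ _ _ c1 (cvgM c2 (IH x))).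
Qed.

(** Near [x] the centre may be frozen to a constant [A]: if [tent y x >= h > 0] it is locally
    constant, and otherwise its coefficient vanishes near [x]. *)
Lemma foam_moment_continuous F : levels_in01 F -> continuous (foam_moment F).
Proof.
elim: F => [|[y h] F IH] hF x /=; first exact: cst_continuous.
have h0 : 0 < h by have /andP[] := hF (y, h) (mem_head _ _).
have c1 := pospart_continuous (@tentB_continuous y h x).
have c2 := pospart_continuous (@Btent_continuous y h x).
have c3 : {for x, continuous (foam_moment F)}.
  by apply: IH => p pF; apply: hF; rewrite inE pF orbT.
have [A hA] : exists A, \forall z \near x,
    (tent y z - h + `|tent y z - h|) *: A =
    (tent y z - h + `|tent y z - h|) *: cube_centre y z.
  have [fh|hf] := ltP (tent y x) h; last first.
    exists (cube_centre y x).
    have := cube_centre_near (lt_le_trans h0 hf).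
    by apply: filterS => z ->.
  exists 0; have : \forall z \near x, tent y z < h.
    exact: (@cvgr_lt _ _ (nbhs x) _ (tent y) (tent y x) (@tent_continuous y x) h fh).
  apply: filterS => z zh; rewrite ler0_norm; last by rewrite subr_le0 ltW.
  by rewrite opprB addrA subrK subrr !scale0r.
apply: (@cvgD _ _ _ (nbhs x)); last exact: cvgZ c2 c3.
rewrite -(nbhs_singleton hA).
apply: cvg_trans (near_eq_cvg hA) _.
exact: (@cvgZr_tmp _ _ _ (nbhs x) _ _ _ _ c1).
Qed.

(** The cube centres for all [y] lie in one lattice of mesh [s / 2]; the shift by [m] indexes its
    points in a box by a finite type. *)
Definition grid_point m (t : {ffun 'I_N -> 'I_(m + m).+1}) : X :=
  \row_i (s / 2 * ((t i)%:R - m%:R)).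

Lemma cube_centre_grid (B : R) m (y : Y) (x : X) :
  (forall i, `|x 0 i| <= B) -> 2 * B / s + 1 <= m%:R ->
  exists t : {ffun 'I_N -> 'I_(m + m).+1}, cube_centre y x = grid_point t.
Proof.
move=> xB hm; have s1 : s != 0 by rewrite gt_eqF.
pose k i : int := 2 * Num.floor (x 0 i / s + phase (y i)) + (y i)%:Z.
have kE i : cube_centre y x 0 i = s / 2 * (k i)%:~R.
  rewrite mxE /k; move: (Num.floor _) => z; rewrite intrD intrM /phase.
  by case: (y i); rewrite /=; field.
have km i : `|(k i)%:~R : R| <= m%:R.
  apply: le_trans hm; have := cube_centre_dist y x i; rewrite kE => h.
  have h2 : `|s / 2 * (k i)%:~R| <= B + s / 2.
    have := ler_normB (x 0 i) (x 0 i - s / 2 * (k i)%:~R).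
    by rewrite opprB addrC subrK => /le_trans; apply; rewrite lerD.
  move: h2; rewrite normrM gtr0_norm ?divr_gt0 // => h2.
  rewrite -(ler_pM2l (divr_gt0 s0 (ltr0n R 2))) (le_trans h2) //.
  by rewrite le_eqVlt; apply/orP; left; apply/eqP; field.
have kn i : exists l : 'I_(m + m).+1, (l%:R : R) = (k i)%:~R + m%:R.
  have := km i; rewrite ler_norml => /andP[k1 k2].
  have k3 : 0 <= k i + m%:Z by rewrite -(ler_int R) intrD -pmulrn; lra.
  have k4 : k i + m%:Z <= (m + m)%:Z by rewrite -(ler_int R) intrD -!pmulrn natrD; lra.
  have aE := gez0_abs k3.
  have lt : (`|(k i + m%:Z)%R|%N < (m + m).+1)%N by rewrite ltnS -lez_nat aE.
  exists (Ordinal lt) => /=.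
  by rewrite pmulrn aE intrD -pmulrn.
have [t tE] := choice kn; exists (finfun t); apply/rowP => i.
by rewrite kE mxE ffunE tE addrK.
Qed.

(** The map [phi] is the mean of [d.+1] cube centres, one for each foam, hence lies in a simplex of
    dimension at most [d] spanned by lattice points. Boundedness of [M] leaves finitely many such
    simplices. Each centre differs from [x] by at most [s / 2] in every coordinate, and so does the
    mean. *)
Lemma linf_width_foams d (M : set X) (B : R) (Fs : seq (seq (Y * R))) :
  (forall x, M x -> forall i, `|x 0 i| <= B) -> size Fs = d.+1 ->
  (forall F, F \in Fs -> levels_in01 F) ->
  (forall x, M x -> exists2 F, F \in Fs & in_cell tent F x) ->
  (linf_width d.+1 M <= (s / 2)%:E)%E.
Proof.
move=> MB sF lF cF; have s20 : 0 <= s / 2 by rewrite divr_ge0 // ltW.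
pose W x := \sum_(F <- Fs) foam_weight F x.
pose V x := \sum_(F <- Fs) foam_moment F x.
have Wc : continuous W.
  have -> : W = fun x => \sum_(F <- Fs) foam_weight F x by [].
  elim: (Fs) => [|F l IH].
    have -> : (fun x => \sum_(F <- [::]) foam_weight F x) = fun=> 0.
      by apply/funext => x; rewrite big_nil.
    exact: cst_continuous.
  have -> : (fun x => \sum_(F <- F :: l) foam_weight F x) =
            (fun x => foam_weight F x + \sum_(F <- l) foam_weight F x).
    by apply/funext => x; rewrite big_cons.
  by move=> x; exact: (@cvgD _ _ _ (nbhs x) _ _ _ _ _ (@foam_weight_continuous F x) (IH x)).
have Vc : continuous V.
  have -> : V = fun x => \sum_(F <- Fs) foam_moment F x by [].
  elim: (Fs) lF => [|F l IH] lF.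
    have -> : (fun x => \sum_(F <- [::]) foam_moment F x) = fun=> 0.
      by apply/funext => x; rewrite big_nil.
    exact: cst_continuous.
  have -> : (fun x => \sum_(F <- F :: l) foam_moment F x) =
            (fun x => foam_moment F x + \sum_(F <- l) foam_moment F x).
    by apply/funext => x; rewrite big_cons.
  have cl : continuous (fun x => \sum_(F <- l) foam_moment F x).
    by apply: IH => F' F'l; apply: lF; rewrite inE F'l orbT.
  move=> x.
  apply: (@cvgD _ _ _ (nbhs x)); last exact: cl.
  exact: (foam_moment_continuous (lF _ (mem_head _ _))).
have W0 x : M x -> 0 < W x.
  move=> /cF[F FF /foam_weight_gt0 w0]; rewrite /W (big_rem _ FF) /=.
  by rewrite ltr_pwDl // sumr_ge0 // => F' _; exact: foam_weight_ge0.
pose phi x := (W x)^-1 *: V x.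
have [m hm] : exists m : nat, 2 * B / s + 1 <= m%:R.
  by exists (Num.truncn (2 * B / s + 1)).+1; rewrite ltW // truncnS_gt.
pose T := {ffun 'I_N -> 'I_(m + m).+1}.
pose Z := {ffun 'I_d.+1 -> T}.
pose v (j : 'I_#|Z|) (i : 'I_d.+1) := grid_point (enum_val j i).
pose FF (i : 'I_d.+1) := nth [::] Fs i.
have sumF (V' : zmodType) (G : seq (Y * R) -> V') : \sum_(F <- Fs) G F = \sum_i G (FF i).
  by rewrite (big_nth [::]) big_mkord sF.
have phiE x : M x -> exists (t : Z) (y : 'I_d.+1 -> Y),
   phi x = \sum_i (foam_weight (FF i) x / W x) *: grid_point (t i) /\
   forall i, grid_point (t i) = cube_centre (y i) x.
  move=> Mx; have [y yE] := choice (fun i => foam_moment_centre (FF i) x).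
  have [t tE] := choice (fun i => cube_centre_grid (y i) (MB x Mx) hm).
  exists (finfun t), y; split; last by move=> i; rewrite ffunE tE.
  rewrite /phi /V sumF scaler_sumr; apply: eq_bigr => i _.
  by rewrite yE scalerA ffunE -tE mulrC.
have w1 x : M x -> \sum_i foam_weight (FF i) x / W x = 1.
  by move=> Mx; rewrite -mulr_suml -(sumF _ (fun F => foam_weight F x)) divff // gt_eqF // W0.
have wi x i : M x -> 0 <= foam_weight (FF i) x / W x.
  by move=> Mx; rewrite divr_ge0 ?foam_weight_ge0 // ltW // W0.
apply: (@le_trans _ _ (ereal_sup [set (linf_norm (x - phi x))%:E | x in M])).
  apply: ereal_inf_lbound; exists phi => //.
  exists (\bigcup_(j in [set j : 'I_#|Z| | True]) conv_hull (v j)); split.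
    by exists #|Z|, v.
  split.
    apply: continuous_in_subspaceT => x; rewrite inE => Mx.
    have Wi : (fun z => (W z)^-1) @ nbhs x --> (W x)^-1.
      by apply: (@cvgV _ _ (nbhs x)); [rewrite gt_eqF // W0|exact: Wc].
    exact: cvgZ Wi (Vc x).
  move=> _ [x Mx <-]; have [t [y [-> _]]] := phiE x Mx.
  exists (enum_rank t) => //; exists (fun i => foam_weight (FF i) x / W x); split.
  - by move=> i; exact: wi.
  - exact: w1.
  - by apply: eq_bigr => i _; rewrite /v enum_rankK.
apply: ge_ereal_sup => _ [x Mx <-]; rewrite lee_fin; apply: linf_norm_le => // l.
have [t [y [-> tE]]] := phiE x Mx.
have -> : (x - \sum_i (foam_weight (FF i) x / W x) *: grid_point (t i)) 0 l =
  \sum_i (foam_weight (FF i) x / W x) * (x 0 l - cube_centre (y i) x 0 l).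
  rewrite !mxE -[x 0 l in LHS]mul1r -(w1 x Mx) mulr_suml summxE -sumrB.
  by apply: eq_bigr => i _; rewrite [X in _ - X]mxE tE mulrBr.
apply: le_trans (ler_norm_sum _ _ _) _.
apply: (@le_trans _ _ (\sum_i foam_weight (FF i) x / W x * (s / 2))); last first.
  by rewrite -mulr_suml w1 // mul1r.
apply: ler_sum => i _; rewrite normrM ger0_norm ?wi //.
by rewrite ler_wpM2l ?wi // cube_centre_dist.
Qed.

End WidthBound.

(** * Flatness of submanifolds *)

Section Flatness.
Variables (R : realType) (n N : nat).
Local Notation U := 'rV[R]_n.
Local Notation X := 'rV[R]_N.

Lemma is_derive_along (g : U -> X) (u v : U) (l : 'I_N) (t : R) :
  differentiable g (u + t *: v) ->
  is_derive t 1 (fun t => g (u + t *: v) 0 l)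
    (\sum_i v 0 i * ('D_(delta_mx 0 i) g (u + t *: v)) 0 l).
Proof.
move=> dg; set w := u + t *: v in dg *.
pose a (t : R) := u + t *: v.
have da : is_diff t a (fun t => t *: v).
  have := is_diffD (is_diff_cst u t) (is_diff_scalel t v).
  by rewrite (_ : 0 + _ = fun t => t *: v) //; apply/funext => z; rewrite /= add0r.
have dga : is_diff t (g \o a) ('d g w \o (fun t : R => t *: v)).
  have dgw : is_diff w g ('d g w) by exact: DiffDef.
  exact: (@is_diff_comp _ _ _ _ a _ g _ t da dgw).
pose c (x : X) : R := x 0 l.
have dc : differentiable c (g w) by exact: differentiable_coord.
have dh : is_diff t (c \o (g \o a)) ('d c (g w) \o ('d g w \o (fun t : R => t *: v))).
  have dcw : is_diff (g w) c ('d c (g w)) by exact: DiffDef.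
  exact: (@is_diff_comp _ _ _ _ (g \o a) _ c _ t dga dcw).
have dcE : 'd c (g w) = c :> (X -> R).
  have c_lin : linear (c : X -> R^o) by move=> z x y; rewrite /c !mxE.
  pose cM := GRing.isLinear.Build _ _ _ _ _ c_lin.
  pose cl : {linear X -> R^o} := HB.pack (c : X -> R^o) cM.
  by rewrite (@diff_lin _ _ _ cl) //; exact: coord_continuous.
apply: DeriveDef.
  by apply/derivable1_diffP; exact: (@ex_diff _ _ _ _ _ _ _ dh).
rewrite deriveE; last exact: (@ex_diff _ _ _ _ _ _ _ dh).
rewrite (@diff_val _ _ _ _ _ _ _ dh) /= scale1r dcE /c.
rewrite [in LHS](row_sum_delta v) linear_sum summxE; apply: eq_bigr => i _.
by rewrite linearZ mxE deriveE.
Qed.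

(** The mean value theorem on the segment from [u'] to [u]. Continuity of the partial derivatives
    allows the derivative at [u0] to serve for all pairs of nearby points. *)
Lemma strict_differentiability (V : set U) (g : U -> X) (u0 : U) (e : R) :
  open V -> V u0 -> smooth_on V g -> 0 < e ->
  exists2 r, 0 < r & forall u u', `|u - u0| < r -> `|u' - u0| < r -> V u /\
    forall l, `|g u 0 l - g u' 0 l -
       \sum_i (u - u') 0 i * ('D_(delta_mx 0 i) g u0) 0 l| <= e * \sum_i `|(u - u') 0 i|.
Proof.
move=> oV Vu0 smg e0; have [dg cg] := smg 1%N.
have hn : \forall w \near u0, V w /\
    forall i, `|'D_(delta_mx 0 i) g u0 - 'D_(delta_mx 0 i) g w| < e.
  apply: filterI; first exact: open_nbhs_nbhs.
  apply: (@filter_forall _ _ (fun i (w : U) =>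
     `|'D_(delta_mx 0 i) g u0 - 'D_(delta_mx 0 i) g w| < e) (nbhs u0)) => i.
  exact: (@cvgr_dist_lt _ _ _ (nbhs u0) _ _ _ (cg i u0 Vu0) e e0).
have /nbhs_ballP[r /= r0 hr] := hn.
have hr' w : `|w - u0| < r -> V w /\
    forall i, `|'D_(delta_mx 0 i) g u0 - 'D_(delta_mx 0 i) g w| < e.
  by move=> wr; apply: hr; rewrite -ball_normE /ball_ /= distrC.
exists r => // u u' ur u'r; split; first by have [] := hr' _ ur.
move=> l; pose v : U := u - u'; pose w (t : R) : U := u' + t *: v.
have wr (t : R) : t \in `[0, 1] -> `|w t - u0| < r.
  rewrite in_itv /= => /andP[t0 t1].
  have -> : w t - u0 = (1 - t) *: (u' - u0) + t *: (u - u0).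
    by rewrite /w /v; apply/rowP => i; rewrite !mxE; ring.
  apply: le_lt_trans (ler_normD _ _) _; rewrite !normrZ !ger0_norm ?subr_ge0 //.
  have : (1 - t) * `|u' - u0| + t * `|u - u0| <=
     (1 - t) * Num.max `|u' - u0| `|u - u0| + t * Num.max `|u' - u0| `|u - u0|.
    by rewrite lerD // ler_wpM2l ?subr_ge0 // le_max lexx ?orbT.
  by rewrite -mulrDl subrK mul1r => /le_lt_trans; apply; rewrite gt_max u'r.
pose df t := \sum_i v 0 i * ('D_(delta_mx 0 i) g (w t)) 0 l.
pose h (t : R) : R := g (w t) 0 l.
have hd (t : R) : t \in `[0, 1] -> is_derive t 1 h (df t).
  by move=> tI; apply: is_derive_along; apply: dg; have [] := hr' _ (wr t tI).
have hd' (t : R) : t \in `]0, 1[ -> is_derive t 1 h (df t).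
  by rewrite in_itv /= => /andP[t0 t1]; apply: hd; rewrite in_itv /= !ltW.
have hc : {within `[0, 1], continuous h}.
  apply: continuous_in_subspaceT => t; rewrite inE => tI.
  apply: differentiable_continuous; apply/derivable1_diffP.
  exact: (@ex_derive _ _ _ _ _ _ _ (hd t tI)).
have [t tI] := MVT_segment ler01 hd' hc.
rewrite /h.
have -> : w 1 = u by rewrite /w /v scale1r addrC subrK.
have -> : w 0 = u' by rewrite /w scale0r addr0.
rewrite subr0 mulr1 => ->.
rewrite -sumrB mulr_sumr; apply: le_trans (ler_norm_sum _ _ _) _.
apply: ler_sum => i _; rewrite -mulrBr normrM mulrC ler_wpM2r // distrC.
have [_ /(_ i) /ltW] := hr' _ (wr t tI); apply: le_trans.
have -> : ('D_(delta_mx 0 i) g u0) 0 l - ('D_(delta_mx 0 i) g (w t)) 0 l =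
  ('D_(delta_mx 0 i) g u0 - 'D_(delta_mx 0 i) g (w t)) 0 l by rewrite !mxE.
exact: coord_le_norm.
Qed.

Definition flat_at (M : set X) (e rho : R) (x0 : X) : Prop :=
  exists E : 'M[R]_(n, N), contractive E /\
    forall x, M x -> eucl_norm (x - x0) <= rho ->
    exists a : 'rV_n, eucl_norm a <= eucl_norm (x - x0) /\
      eucl_norm (x - x0 - a *m E) <= e * eucl_norm (x - x0).

(** By strict differentiability of the chart the Jacobian [J] at [p] serves for all centres near
    [p]. Projecting onto the plane obtained by orthonormalising its rows is at least as good as the
    approximation by [v *m J]. *)
Lemma locally_flat (M : set X) p (e : R) : closed_submanifold n M -> M p -> 0 < e ->
  exists2 r, 0 < r & forall x0, M x0 -> eucl_norm (x0 - p) < r -> flat_at M e r x0.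
Proof.
move=> [_ hM] Mp e0; have [f [W [V [g [_ [oW Wp] oV [smg pg] MW]]]]] := hM p Mp.
have gproj x : M x -> W x -> V (coord_proj f x) /\ x = g (coord_proj f x).
  move=> Mx Wx; have : (M `&` W) x by [].
  by rewrite MW => -[_ [u Vu gu]]; rewrite -gu pg.
set u0 := coord_proj f p; have [Vu0 _] := gproj p Mp Wp.
(* Pays for passing between Euclidean norms and sums over coordinates, once in each space. *)
pose C : R := N%:R * n%:R + 1; have C0 : 0 < C by rewrite ltr_wpDl // mulr_ge0.
have [r r0 hr] := strict_differentiability oV Vu0 smg (divr_gt0 e0 C0).
have projB x x' i : (coord_proj f x - coord_proj f x') 0 i = (x - x') 0 (f i).
  by rewrite !mxE.
have proj_near x : eucl_norm (x - p) < r -> `|coord_proj f x - u0| < r.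
  move=> xr; rewrite [`|_|]mx_normrE; apply: bigmax_lt => // -[i j] _ /=.
  by rewrite (ord1 i) projB (le_lt_trans (coord_le_enorm _ _)).
have /nbhs_ballP[r1 /= r10 hr1] := open_nbhs_nbhs (conj oW Wp).
have Wnear x : eucl_norm (x - p) < r1 -> W x.
  move=> xr; apply: hr1; rewrite -ball_normE /ball_ /= distrC [`|_|]mx_normrE.
  by apply: bigmax_lt => // -[i j] _ /=; rewrite (ord1 i) (le_lt_trans (coord_le_enorm _ _)).
pose J : 'M[R]_(n, N) := \matrix_(i, l) ('D_(delta_mx 0 i) g u0) 0 l.
have [E [hE hJ]] := gram_schmidt J.
(* Half the radius: a point within [r2] of a centre within [r2] of [p] stays in both
   neighbourhoods. *)
pose r2 := Num.min r r1 / 2.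
have r20 : 0 < r2 by rewrite divr_gt0 // lt_min r0.
exists r2 => // x0 Mx0 x0p; exists E; split; first exact: partial_isometry_contraction.
move=> x Mx xx0.
have near2 z : eucl_norm (z - p) < 2 * r2 -> eucl_norm (z - p) < r /\ eucl_norm (z - p) < r1.
  have -> : 2 * r2 = Num.min r r1 by rewrite /r2; field.
  by rewrite lt_min => /andP[].
have [x0r x0r1] : eucl_norm (x0 - p) < r /\ eucl_norm (x0 - p) < r1.
  by apply: near2; lra.
have [xr xr1] : eucl_norm (x - p) < r /\ eucl_norm (x - p) < r1.
  by apply: near2; have := enorm_trans x0 x p; lra.
have [Vx xE] := gproj x Mx (Wnear x xr1).
have [Vx0 x0E] := gproj x0 Mx0 (Wnear x0 x0r1).
set v := coord_proj f x - coord_proj f x0.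
exists ((x - x0) *m E^T); split.
  apply: partial_isometry_contraction; rewrite trmxK; exact: partial_isometry_tr.
apply: le_trans (partial_isometry_proj (w := v *m J) _ hE _) _.
  by rewrite -!mulmxA [J *m _]mulmxA hJ.
have [_ hd] := hr _ _ (proj_near x xr) (proj_near x0 x0r).
apply: le_trans (enorm_le_sum _) _.
have sv : \sum_i `|v 0 i| <= n%:R * eucl_norm (x - x0).
  apply: (@le_trans _ _ (\sum_(i < n) eucl_norm (x - x0))).
    by apply: ler_sum => i _; rewrite projB coord_le_enorm.
  by rewrite sumr_const card_ord mulr_natl.
have hl l : `|(x - x0 - v *m J) 0 l| <= e / C * (n%:R * eucl_norm (x - x0)).
  have -> : (x - x0 - v *m J) 0 l = g (coord_proj f x) 0 l - g (coord_proj f x0) 0 l -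
       \sum_i v 0 i * ('D_(delta_mx 0 i) g u0) 0 l.
    rewrite -xE -x0E !mxE; congr (_ - _); apply: eq_bigr => i _.
    by rewrite [J _ _]mxE.
  by apply: le_trans (hd l) _; rewrite ler_wpM2l // divr_ge0 // ltW.
apply: (@le_trans _ _ (\sum_(l < N) e / C * (n%:R * eucl_norm (x - x0)))).
  by apply: ler_sum => l _.
rewrite sumr_const card_ord -[leLHS]mulr_natl.
rewrite [leLHS](_ : _ = (e * eucl_norm (x - x0)) * ((N%:R * n%:R) / C)); last by ring.
by rewrite ler_piMr ?mulr_ge0 ?enorm_ge0 ?(ltW e0) // ler_pdivrMr // mul1r lerDl.
Qed.

(** Compactness in its near-covering form: what holds near each point for all small [rho] holds on
    [M] for a common [rho]. *)
Lemma uniformly_flat (M : set X) (e : R) : closed_submanifold n M -> 0 < e ->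
  exists2 rho, 0 < rho & forall x0, M x0 -> flat_at M e rho x0.
Proof.
move=> hM e0; have [/compact_near_coveringP cM _] := hM.
have hloc p : M p -> \forall x0 \near p & rho \near 0^'+, M x0 -> flat_at M e rho x0.
  move=> Mp; have [r r0 hr] := locally_flat hM Mp e0.
  exists ([set x | eucl_norm (x - p) < r], [set rho | 0 < rho < r]) => /=.
    split; first exact: enorm_small.
    by near=> t; apply/andP; split.
  move=> [x rho] [/= xr /andP[rho0 rhor]] Mx.
  have [E [hE fl]] := hr x Mx xr; exists E; split => // z Mz zr.
  by apply: fl => //; rewrite (le_trans zr) // ltW.
have h := cM R (0^'+) (fun rho x0 => M x0 -> flat_at M e rho x0) _ hloc.
have {}h := h (at_right_proper_filter _).
have h0 : \forall t \near (0 : R)^'+, 0 < t by exact: nbhs_right_gt.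
have [rho [rho0 hrho]] := filter_ex (filterI h0 h).
by exists rho => // x0 Mx0; apply: hrho.
Unshelve. all: by end_near. Qed.

End Flatness.

(** * Hausdorff covers *)

Section HausdorffCover.
Variables (R : realType) (n N : nat).
Local Notation X := 'rV[R]_N.

Lemma unit_ball_vol_gt0 k : 0 < unit_ball_vol R k.
Proof.
suff : 0 < unit_ball_vol R k /\ 0 < unit_ball_vol R k.+1 by case.
elim: k => [|k [IH1 IH2]]; first by split; rewrite /= ?ltr01 ?ltr0n.
by split => //=; rewrite mulr_gt0 // divr_gt0 // mulr_gt0 // pi_gt0.
Qed.

Lemma eucl_diam_ge0 (A : set X) : (0 <= eucl_diam A)%E.
Proof. by apply: ereal_sup_ubound; left. Qed.

Lemma eucl_diam_fine (A : set X) (delta : R) x y :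
  (eucl_diam A <= delta%:E)%E -> A x -> A y -> eucl_norm (x - y) <= fine (eucl_diam A).
Proof.
move=> hA Ax Ay; have fA : eucl_diam A \is a fin_num.
  rewrite ge0_fin_numE ?eucl_diam_ge0 //; exact: le_lt_trans hA (ltry _).
rewrite -lee_fin fineK //; apply: ereal_sup_ubound; right.
by exists x => //; exists y.
Qed.

Lemma exprn_radius_margin (a D e : R) k : 0 < e ->
  exists2 t, 0 < t <= e & a * (D + t) ^+ k <= a * D ^+ k + e.
Proof.
move=> e0; have cont : (fun t : R => a * (D + t) ^+ k) @ (0 : R) --> a * (D + 0) ^+ k.
  apply: cvgM; first exact: cvg_cst.
  apply: (cvg_comp (fun t : R => D + t) (fun z : R => z ^+ k)).
    by apply: cvgD; [exact: cvg_cst|exact: cvg_id].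
  exact: exprn_continuous.
rewrite addr0 in cont.
have h1 : \forall t \near (0 : R)^'+, a * (D + t) ^+ k < a * D ^+ k + e.
  have := cvg_at_right_filter cont.
  by move=> /cvgr_lt; apply; rewrite ltrDl.
have [t [[t0 te] /ltW ht]] :=
  filter_ex (filterI (filterI (nbhs_right_gt (0 : R)) (nbhs_right_le e0)) h1).
by exists t => //; rewrite t0.
Qed.

Lemma open_eball (c : X) (r : R) : open [set x | eucl_norm (x - c) < r].
Proof.
rewrite openE => x /= hx; have rx : 0 < r - eucl_norm (x - c) by rewrite subr_gt0.
have := enorm_small x rx; apply: filterS => y /= hy.
by have := enorm_trans x y c; lra.
Qed.

(** A covering set that meets [M] is replaced by a ball about one of the points of [M] in it, with
    radius slightly above its diameter. The open balls have a finite subcover, and the excesses are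
    summable. *)
Lemma hausdorff_cover (M : set X) (v delta e : R) :
  compact M -> hausdorff_measure n M = v%:E -> 0 < delta -> 0 < e ->
  exists (K : nat) (S : 'I_K -> set X) (d : 'I_K -> R),
   [/\ forall i, 0 < d i <= delta,
       forall i, (forall x, ~ S i x) \/
         exists2 x0, M x0 & forall x, S i x -> M x /\ eucl_norm (x - x0) <= d i,
       forall x, M x -> exists i, S i x &
       \sum_i unit_ball_vol R n * (d i / 2) ^+ n <= v + e].
Proof.
move=> cM hv delta0 e0; have d20 : 0 < delta / 2 by rewrite divr_gt0.
have : (hausdorff_pre n (delta / 2) M < (v + e / 2)%:E)%E.
  apply: (@le_lt_trans _ _ v%:E); last by rewrite lte_fin ltrDl divr_gt0.
  by rewrite -hv; apply: ereal_sup_ubound; exists (delta / 2).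
move=> /ereal_inf_lt[_ [E [ME dE] <-]] sumE.
pose D i := fine (eucl_diam (E i)).
have D0 i : 0 <= D i by rewrite fine_ge0 // eucl_diam_ge0.
have Dd i : D i <= delta / 2.
  rewrite -lee_fin fineK // ge0_fin_numE ?eucl_diam_ge0 //.
  exact: le_lt_trans (dE i) (ltry _).
pose a : R := unit_ball_vol R n / 2 ^+ n.
(* The first bound keeps the radii below [delta], the second makes the excesses sum to at most
   [e / 2]. *)
pose e' i : R := Num.min (delta / 2) (e / 2 * (1 / 2) ^+ i.+1).
have e'0 i : 0 < e' i.
  by rewrite lt_min d20 /= mulr_gt0 ?exprn_gt0 ?divr_gt0.
have [t ht] := choice (fun i => let: ex_intro2 t h1 h2 := exprn_radius_margin a (D i) n (e'0 i)
   in ex_intro (fun t => 0 < t <= e' i /\ a * (D i + t) ^+ n <= a * D i ^+ n + e' i) t (conj h1 h2)).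
have aE z : unit_ball_vol R n * (z / 2) ^+ n = a * z ^+ n.
  by rewrite /a expr_div_n; ring.
have hx i : exists z, (E i `&` M) !=set0 -> E i z /\ M z.
  by have [[z [Ez Mz]]|h] := pselect ((E i `&` M) !=set0); [exists z|exists 0].
have [c hc] := choice hx.
pose O i := [set x : X | eucl_norm (x - c i) < D i + t i].
move: cM; rewrite compact_cover => /(_ nat [set i | (E i `&` M) !=set0] O _ _)[].
- by move=> i _; exact: open_eball.
- move=> x Mx; have [i _ Eix] := ME x Mx.
  have EM : (E i `&` M) !=set0 by exists x.
  have [Ec Mc] := hc i EM; exists i => //=.
  apply: le_lt_trans (eucl_diam_fine (dE i) Eix Ec) _.
  by rewrite ltrDl; case: (ht i) => /andP[].
move=> D' D'E D'M.
(* Keeping all indices up to the largest one makes the total a partial sum of the series. *)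
pose K := (\max_(i <- finmap.enum_fset D') i).+1.
exists K, (fun i : 'I_K => [set x | [/\ M x, (E i `&` M) !=set0 & eucl_norm (x - c i) <= D i + t i]]),
  (fun i : 'I_K => D i + t i); split.
- move=> i; case: (ht i) => /andP[t0]; rewrite /e' le_min => /andP[td _] _.
  by apply/andP; split; [rewrite ltr_wpDl|have := Dd i; lra].
- move=> i; have [h|h] := pselect ((E i `&` M) !=set0); last by left => x [].
  by right; exists (c i) => [|x [Mx _ xc]]; [case: (hc i h)|].
- move=> x Mx; have [i /= iD xO] := D'M x Mx.
  have iK : (i < K)%N by rewrite ltnS; apply: (leq_bigmax_seq (F := id)).
  exists (Ordinal iK); split => //=; last exact: ltW.
  by have := D'E i iD; rewrite inE.
- under eq_bigr do rewrite aE.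
  apply: (@le_trans _ _ (\sum_(i < K) (a * D i ^+ n + e / 2 * (1 / 2) ^+ i.+1))).
    apply: ler_sum => i _; case: (ht i) => _ /le_trans; apply.
    by rewrite lerD2l /e' ge_min lexx orbT.
  rewrite big_split /= -[X in _ + X]mulr_sumr.
  have geo k : \sum_(i < k) (1 / 2 : R) ^+ i.+1 = 1 - (1 / 2) ^+ k.
    elim: k => [|k IH]; first by rewrite big_ord0 expr0 subrr.
    by rewrite big_ord_recr /= IH exprS; field.
  have h1 : \sum_(i < K) a * D i ^+ n <= v + e / 2.
    rewrite -lee_fin -sumEFin; apply: le_trans (ltW sumE).
    have h2 i : (0 <= (unit_ball_vol R n * (fine (eucl_diam (E i)) / 2) ^+ n)%:E)%E.
      by rewrite lee_fin mulr_ge0 ?(ltW (unit_ball_vol_gt0 n)) // exprn_ge0 // divr_ge0 // D0.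
    have := @nneseries_lim_ge R (fun i => (unit_ball_vol R n *
       (fine (eucl_diam (E i)) / 2) ^+ n)%:E) xpredT 0%N K (fun i _ _ => h2 i).
    rewrite big_mkord; apply: le_trans.
    by apply: lee_sum => i _; rewrite lee_fin aE.
  have h3 : e / 2 * (\sum_(i < K) (1 / 2 : R) ^+ i.+1) <= e / 2.
    rewrite geo ler_piMr ?(ltW (divr_gt0 e0 _)) // ?lerBlDr ?lerDl ?exprn_ge0 //.
  by lra.
Qed.

End HausdorffCover.

(** * From volume to width *)

Section WidthOfSubmanifold.
Variables (R : realType).

(** A ball of the Hausdorff cover is a flat piece with [b = 1], whence the factor [expR lam]; the
    factor [2 ^+ n] arises because its radius is compared with half a diameter. *)
Lemma linf_width_le (n N : nat) (M : set 'rV[R]_N) (v s lam : R) :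
  (0 < n)%N -> closed_submanifold n M -> hausdorff_measure n M = v%:E ->
  0 < s -> 0 < lam -> 0 <= v ->
  foam_const (pi / s) lam n * (expR lam * (2 ^+ n / unit_ball_vol R n)) * v < 1 ->
  (linf_width n M <= (s / 2)%:E)%E.
Proof.
move=> n0 hM hv s0 lam0 v0 hlt; have om0 := om_gt0 s0.
set A := expR lam * (2 ^+ n / unit_ball_vol R n) in hlt.
have A0 : 0 < A.
  by rewrite mulr_gt0 ?expR_gt0 // divr_gt0 ?unit_ball_vol_gt0 ?exprn_gt0.
set c := foam_const _ _ _ in hlt.
have c0 : 0 <= c by exact: foam_const_ge0.
(* One slack for both the foam constant and the volume. *)
have [e e0 he] : exists2 e, 0 < e & (c + e) * A * (v + e) < 1.
  have [|e e0 he] := @small_enough R [:: (1, 1); (2 * (A * (c + v + 1)), 1 - c * A * v)].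
    move=> p; rewrite !inE => /orP[] /eqP -> /=; split => //; last by rewrite subr_gt0.
    by rewrite mulr_ge0 // mulr_ge0 ?(ltW A0) // !addr_ge0.
  have e1 : e <= 1 by have := he _ (mem_head _ _); rewrite /= mul1r.
  have e2 := he (2 * (A * (c + v + 1)), 1 - c * A * v).
  rewrite !inE eqxx orbT /= in e2; have {}e2 := e2 isT.
  exists e => //; apply: (@lt_le_trans _ _ (c * A * v + 2 * (A * (c + v + 1)) * e)); last by lra.
  rewrite -subr_gt0 [ltRHS](_ : _ = A * e * (c + v + 2 - e)); last by ring.
  by rewrite mulr_gt0 ?(mulr_gt0 A0 e0) //; lra.
have cG : c < c + e by rewrite ltrDl.
have [eps [del [eps0 del0 fc]]] := foams_cover N om0 lam0 ler01 cG.
have [rho rho0 hflat] := uniformly_flat hM eps0.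
have delta0 : 0 < Num.min del rho by rewrite lt_min del0.
have [K [S [d [d0 hS MS sumd]]]] := hausdorff_cover hM.1 hv delta0 e0.
pose w i := (c + e) * expR lam * d i ^+ n.
have ce0 : 0 <= c + e by rewrite addr_ge0 // ltW.
have d0' i : 0 < d i by case/andP: (d0 i).
have dn i : 0 <= d i ^+ n by rewrite exprn_ge0 // ltW.
have [||Fs [sF lF cF]] := fc 'I_K S w.
- move=> i; split; first by rewrite /w !mulr_ge0 ?expR_ge0.
  case: (hS i) => [h|[x0 Mx0 h]]; first by constructor 1.
  have [E [hE fl]] := hflat x0 Mx0.
  have /andP[_] := d0 i; rewrite le_min => /andP[ddel drho].
  constructor 2; exists E, x0, (d i), 1; split => //.
  + split => // x /h[Mx xd]; have [|a [ax xa]] := fl x Mx; first exact: le_trans xd drho.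
    exists a; split; last by rewrite (le_trans xa) // ler_wpM2l // ltW.
    rewrite mul1r -enorm_leP ?(le_trans ax) // ltW //.
  + by rewrite d0'.
  + by rewrite mulr1.
- rewrite /w -mulr_sumr; apply: le_lt_trans he.
  have u0 := unit_ball_vol_gt0 R n.
  have -> : \sum_i d i ^+ n = 2 ^+ n / unit_ball_vol R n *
      \sum_i unit_ball_vol R n * (d i / 2) ^+ n.
    rewrite mulr_sumr; apply: eq_bigr => i _; rewrite expr_div_n; field.
    by rewrite !gt_eqF // exprn_gt0.
  rewrite /A !mulrA -!(mulrA ((c + e) * expR lam)) ler_wpM2l ?mulr_ge0 ?expR_ge0 //.
  by rewrite ler_wpM2l // divr_ge0 ?exprn_ge0 // ltW.
have /compact_bounded[B [_ hB]] := hM.1.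
apply: (linf_width_foams s0 (B := B + 1) _ _ lF).
- move=> x Mx i; apply: le_trans (coord_le_norm _ _) _.
  by apply: hB => //; rewrite ltrDl.
- by rewrite prednK.
- by move=> x /MS[i Six]; exact: cF Six.
Qed.

End WidthOfSubmanifold.

(** * Constants *)

Section Constants.
Variable R : realType.
Local Notation om n := (unit_ball_vol R n).

Lemma pi_ge2 : 2 <= pi :> R.
Proof. by have := pihalf_ge1 R; rewrite ler_pdivlMr // mul1r. Qed.

(** Proved for two consecutive [k] at once, since the recursion for the volumes has step two. *)
Lemma unit_ball_vol_ratio k : 2 * om k <= k.+1%:R * om k.+1.
Proof.
suff : 2 * om k <= k.+1%:R * om k.+1 /\ 2 * om k.+1 <= k.+2%:R * om k.+2 by case.
elim: k => [|k [IH1 IH2]].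
  split; first by rewrite /= mulr1 mul1r.
  rewrite /= mulr1; have -> : 2%:R * (2 * pi / 2%:R) = 2 * pi :> R by field.
  by rewrite ler_wpM2l // pi_ge2.
split => //; have k2 : k.+2%:R != 0 :> R by rewrite pnatr_eq0.
have k3 : k.+3%:R != 0 :> R by rewrite pnatr_eq0.
rewrite [om k.+2]/= [om k.+3]/= -/(om k) -/(om k.+1).
rewrite [leRHS](_ : _ = 2 * pi * om k.+1); last by field.
rewrite [leLHS](_ : _ = 2 * pi * (2 * om k / k.+2%:R)); last by field.
rewrite ler_wpM2l ?mulr_ge0 ?pi_ge0 // ler_pdivrMr ?ltr0n // [leRHS]mulrC.
by rewrite (le_trans IH1) // ler_wpM2r ?ler_nat // ltW // unit_ball_vol_gt0.
Qed.

(** Products of consecutive volumes have a closed form free of parity cases; the ratio bound then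
    isolates a single volume. *)
Lemma unit_ball_vol_prod k : (k.+1)`!%:R * om k.+1 * om k = 2 * (2 * pi) ^+ k.
Proof.
elim: k => [|k IH]; first by rewrite /= expr0 !mulr1 mul1r.
have k2 : k.+2%:R != 0 :> R by rewrite pnatr_eq0.
rewrite [om k.+2]/= -/(om k) factS natrM exprS.
rewrite [LHS](_ : _ = 2 * pi * (k.+1`!%:R * om k.+1 * om k)); last by field.
by rewrite IH; ring.
Qed.

Lemma unit_ball_vol_sqr k :
  4 * (2 * pi) ^+ k <= k.+1%:R * (k.+1)`!%:R * om k.+1 ^+ 2.
Proof.
have := unit_ball_vol_prod k; have := unit_ball_vol_ratio k.
have := unit_ball_vol_gt0 R k.+1; set a := om k.+1; set b := om k.
move=> a0 h h2; rewrite [leLHS](_ : _ = 2 * (2 * (2 * pi) ^+ k)); last by ring.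
rewrite -h2; rewrite [leLHS](_ : _ = (k.+1`!%:R * a) * (2 * b)); last by ring.
rewrite [leRHS](_ : _ = (k.+1`!%:R * a) * (k.+1%:R * a)); last by ring.
by rewrite ler_wpM2l // mulr_ge0 // ltW.
Qed.

(** A weak Stirling bound, [n! <= e n (n / e)^n] with [n = k + 1]. The induction step is
    [(1 - 1 / m)^m <= 1 / e] with [m = k + 2]. *)
Lemma fact_expR_le k : (k.+1)`!%:R * expR 1 ^+ k <= k.+1%:R ^+ k.+2 :> R.
Proof.
elim: k => [|k IH]; first by rewrite expr0 mulr1 factS fact0 muln1 expr1n.
have e0 : 0 < expR 1 :> R by exact: expR_gt0.
have h : expR 1 * k.+1%:R ^+ k.+2 <= k.+2%:R ^+ k.+2 :> R.
  have k2 : 0 < k.+2%:R :> R by rewrite ltr0n.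
  have h1 : k.+1%:R / k.+2%:R <= expR (- k.+2%:R^-1) :> R.
    apply: le_trans (expR_ge1Dx _).
    have -> : k.+1%:R = k.+2%:R - 1 :> R by rewrite -[k.+2%:R]natr1 addrK.
    by rewrite le_eqVlt; apply/orP; left; apply/eqP; field; rewrite gt_eqF.
  have h2 : (k.+1%:R / k.+2%:R) ^+ k.+2 <= expR (-1) :> R.
    have -> : expR (-1) = expR (- k.+2%:R^-1) ^+ k.+2 :> R.
      by rewrite -expRM_natl; congr expR; field; rewrite gt_eqF.
    by rewrite lerXn2r ?nnegrE ?expR_ge0 // divr_ge0.
  move: h2; rewrite expr_div_n expRN ler_pdivrMr ?exprn_gt0 // mulrC.
  by rewrite ler_pdivlMr // mulrC.
rewrite factS natrM exprS [k.+2%:R ^+ _]exprS -mulrA ler_wpM2l //.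
by rewrite mulrCA (le_trans _ h) // ler_wpM2l // ltW.
Qed.

(* The exponential factor is at least [(2 e^2 n^3)^(1/(2n))]: it absorbs the
   polynomial losses in [n] of the bounds on [n!], on the volume of the unit ball
   and of the Gaussian weights. *)
Definition width_const (n : nat) : R :=
  2 * pi / Num.sqrt (expR 1) * expR ((3 + 3 * ln n%:R) / (2 * n%:R)).

Lemma width_const_gt0 n : 0 < width_const n.
Proof. by rewrite !mulr_gt0 ?invr_gt0 ?sqrtr_gt0 ?expR_gt0 ?pi_gt0. Qed.

Lemma ln_nat_le n : (0 < n)%N -> ln n%:R <= n%:R - 1 :> R.
Proof.
move=> n0; have := expR_ge1Dx (ln n%:R : R); rewrite lnK ?posrE ?ltr0n //; lra.
Qed.

Lemma width_const_bounded : exists B : R, forall n, (0 < n)%N -> width_const n <= B.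
Proof.
exists (2 * pi / Num.sqrt (expR 1) * expR (3 / 2)) => n n0.
rewrite ler_wpM2l ?divr_ge0 ?mulr_ge0 ?pi_ge0 ?sqrtr_ge0 // ler_expR.
have n1 : 0 < n%:R :> R by rewrite ltr0n.
rewrite ler_pdivrMr ?mulr_gt0 //; have := ln_nat_le n0; lra.
Qed.

Lemma width_const_cvg : width_const n @[n --> \oo] --> 2 * pi / Num.sqrt (expR 1).
Proof.
suff h : (3 + 3 * ln n%:R) / (2 * n%:R) @[n --> \oo] --> (0 : R).
  have h1 := cvg_comp _ _ h (@continuous_expR R 0); rewrite expR0 in h1.
  have := cvgM (cvg_cst (2 * pi / Num.sqrt (expR 1))) h1.
  by rewrite mulr1; apply.
apply/cvgrPdist_lt => e e0.
(* With this [K], the bound [ln n <= n / K - 1 + ln K] makes [3 * ln n] at most [n * e] plus a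
   constant; beyond the threshold [A] a second [n * e] covers the constants. *)
pose K : R := 3 / e; have K0 : 0 < K by rewrite divr_gt0.
pose A := 3 * (`|ln K| + 1) / e.
have A0 : 0 <= A by rewrite divr_ge0 ?mulr_ge0 ?addr_ge0 // ltW.
near=> n.
have nA : A < n%:R by near: n; exact: nbhs_infty_gtr.
have n0 : 0 < n%:R :> R by exact: le_lt_trans nA.
have n1 : (0 < n)%N by rewrite -(ltr0n R).
have l0 : 0 <= ln n%:R :> R by rewrite ln_ge0 // ler1n.
rewrite sub0r normrN ger0_norm; last by rewrite divr_ge0 ?addr_ge0 ?mulr_ge0 // ltW.
rewrite ltr_pdivrMr ?mulr_gt0 //.
have lnb : ln n%:R <= n%:R / K - 1 + ln K.
  have -> : ln n%:R = ln (n%:R / K) + ln K :> R.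
    by rewrite -lnM ?posrE ?divr_gt0 // divfK // gt_eqF.
  rewrite lerD2r; have := expR_ge1Dx (ln (n%:R / K)).
  by rewrite lnK ?posrE ?divr_gt0 //; lra.
have nK : n%:R / K = n%:R * e / 3 by rewrite /K; field; rewrite gt_eqF.
have lnK' := ler_norm (ln K).
have : 3 * (`|ln K| + 1) < n%:R * e by move: nA; rewrite /A ltr_pdivrMr.
by move: lnb; rewrite nK; lra.
Unshelve. all: by end_near. Qed.

Lemma foam_constE (s lam : R) k :
  foam_const (pi / s) lam k =
  (2 * pi / s) ^+ k * Num.sqrt k`!%:R * Num.sqrt (pi / lam) ^+ k.
Proof.
elim: k => [|k IH]; first by rewrite /foam_const big_ord0 !expr0 fact0 sqrtr1 !mulr1.
rewrite /foam_const big_ord_recr /= -/(foam_const _ _ k) IH factS natrM sqrtrM // !exprS.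
ring.
Qed.

(** The value [lam = n / 2] minimises [expR lam * (pi / lam)^(n / 2)]. With it the left side is
    [(4 * pi / s) ^+ n * Kn * v], and the claim reduces to [Kn <= T ^+ n]. *)
Lemma width_const_spec n (s v : R) : (0 < n)%N -> 0 <= v ->
  width_const n * Num.sqrt n%:R * v `^ (n%:R)^-1 < s / 2 ->
  foam_const (pi / s) (n%:R / 2) n * (expR (n%:R / 2) * (2 ^+ n / om n)) * v < 1.
Proof.
move=> n0 v0 hs; have n1 : 0 < n%:R :> R by rewrite ltr0n.
have s0 : 0 < s.
  have : 0 <= width_const n * Num.sqrt n%:R * v `^ n%:R^-1.
    by rewrite mulr_ge0 ?powR_ge0 // mulr_ge0 ?sqrtr_ge0 ?(ltW (width_const_gt0 n)).
  by move: hs; lra.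
pose T : R := expR ((3 + 3 * ln n%:R) / (2 * n%:R)) / Num.sqrt (expR 1) * Num.sqrt n%:R.
have T0 : 0 <= T by rewrite !mulr_ge0 ?invr_ge0 ?sqrtr_ge0 ?expR_ge0.
have WT : width_const n * Num.sqrt n%:R = 2 * pi * T.
  by rewrite /width_const /T; ring.
have om0 := unit_ball_vol_gt0 R n.
pose Kn : R := Num.sqrt n`!%:R * Num.sqrt (pi / (n%:R / 2)) ^+ n * expR (n%:R / 2) / om n.
have Kn0 : 0 <= Kn by rewrite divr_ge0 ?(ltW om0) // !mulr_ge0 ?exprn_ge0 ?sqrtr_ge0 ?expR_ge0.
(* Squaring removes the roots. [unit_ball_vol_sqr] then eliminates the volume, the square of
   [fact_expR_le] the factorials, and [pi / 2 <= expR 1] remains. *)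
have KT : Kn <= T ^+ n.
  rewrite -ler_sqr ?nnegrE ?exprn_ge0 //.
  have T2 : (T ^+ n) ^+ 2 = expR 1 ^+ 3 * n%:R ^+ 3 * n%:R ^+ n / expR 1 ^+ n.
    pose q : R := (3 + 3 * ln n%:R) / (2 * n%:R).
    have TT : T ^+ 2 = expR q ^+ 2 * n%:R / expR 1.
      by rewrite /T -/q !exprMn exprVn !sqr_sqrtr ?expR_ge0 //; ring.
    rewrite exprAC TT 2!exprMn [(expR 1)^-1 ^+ n]exprVn -exprM -[expR q ^+ _]expRM_natl.
    have -> : (2 * n)%:R * q = 3%:R * 1 + 3%:R * ln n%:R :> R.
      by rewrite natrM /q; field; rewrite gt_eqF.
    by rewrite expRD !expRM_natl lnK ?posrE.
  have K2 : Kn ^+ 2 = n`!%:R * (2 * pi) ^+ n * expR 1 ^+ n / (n%:R ^+ n * om n ^+ 2).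
    have pn : 0 <= pi / (n%:R / 2) :> R by rewrite divr_ge0 ?pi_ge0 // divr_ge0 // ltW.
    have -> : Kn ^+ 2 = Num.sqrt n`!%:R ^+ 2 * (Num.sqrt (pi / (n%:R / 2)) ^+ 2) ^+ n *
        expR (n%:R / 2) ^+ 2 / om n ^+ 2.
      by rewrite [_ ^+ 2 ^+ n]exprAC /Kn !exprMn exprVn.
    rewrite !sqr_sqrtr //.
    have -> : expR (n%:R / 2) ^+ 2 = expR 1 ^+ n :> R.
      by rewrite -!expRM_natl; congr expR; field.
    have -> : pi / (n%:R / 2) = 2 * pi / n%:R :> R by field; rewrite gt_eqF.
    by rewrite expr_div_n; field; rewrite !gt_eqF ?exprn_gt0.
  rewrite T2 K2; case: n n0 n1 {hs T T0 WT Kn Kn0 T2 K2} om0 => // k _ n1 om0.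
  have V := unit_ball_vol_sqr k; have F := fact_expR_le k.
  have e0 : 0 < expR 1 :> R by exact: expR_gt0.
  have e2 : 2 <= expR 1 :> R by have := expR_ge1Dx (1 : R); lra.
  set e := expR 1 in F e0 e2 *; set n := k.+1%:R in n1 V F *.
  have f0 : 0 <= k.+1`!%:R :> R by [].
  set f := k.+1`!%:R in V F f0 *.
  have o2 : 0 < om k.+1 ^+ 2 by rewrite exprn_gt0.
  rewrite ler_pdivrMr; last by rewrite mulr_gt0 // exprn_gt0.
  rewrite [leRHS]mulrAC ler_pdivlMr ?exprn_gt0 //.
  have FF : (f * e ^+ k) ^+ 2 <= (n ^+ k.+2) ^+ 2.
    have h1 : 0 <= f * e ^+ k by rewrite mulr_ge0 // exprn_ge0 // ltW.
    have h2 : 0 <= n ^+ k.+2 by rewrite exprn_ge0 // ltW.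
    by rewrite ler_sqr ?nnegrE.
  have pi4 : pi <= 4 :> R by have := pihalf_02 R => /andP[_]; lra.
  have n1' := ltW n1; have e0' := ltW e0; have ek0 : 0 <= e ^+ k by exact: exprn_ge0.
  have nk0 : 0 <= n ^+ k.+2 by exact: exprn_ge0.
  have om0' := ltW om0; have ip : 0 <= pi / 2 :> R by rewrite divr_ge0 // pi_ge0.
  have V' : f * (e ^+ k) ^+ 2 * e ^+ 2 * (pi / 2) * (4 * (2 * pi) ^+ k) <=
            f * (e ^+ k) ^+ 2 * e ^+ 2 * (pi / 2) * (n * f * om k.+1 ^+ 2).
    by apply: ler_wpM2l V; rewrite (mulr_ge0 _ ip) // !mulr_ge0.
  have F' : n * om k.+1 ^+ 2 * e ^+ 2 * (pi / 2) * (f * e ^+ k) ^+ 2 <=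
            n * om k.+1 ^+ 2 * e ^+ 2 * (pi / 2) * (n ^+ k.+2) ^+ 2.
    by apply: ler_wpM2l FF; rewrite (mulr_ge0 _ ip) // !mulr_ge0.
  have E' : pi / 2 * (n * om k.+1 ^+ 2 * (n ^+ k.+2) ^+ 2 * e ^+ 2) <=
            e * (n * om k.+1 ^+ 2 * (n ^+ k.+2) ^+ 2 * e ^+ 2).
    by rewrite ler_wpM2r ?(mulr_ge0 _ (sqr_ge0 e)) ?(mulr_ge0 _ (sqr_ge0 _)) //; lra.
  move: V' F' E'; rewrite !(exprSr _ k.+1) !(exprSr _ k).
  move: (om k.+1) (e ^+ k) (n ^+ k) ((2 * pi) ^+ k) => o ek nk pk V' F' E'.
  rewrite [leLHS](_ : _ = f * ek ^+ 2 * e ^+ 2 * (pi / 2) * (4 * pk)); last by field.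
  apply: le_trans V' _.
  rewrite [leLHS](_ : _ = n * o ^+ 2 * e ^+ 2 * (pi / 2) * (f * ek) ^+ 2); last by ring.
  apply: le_trans F' _.
  rewrite [leLHS](_ : _ = pi / 2 * (n * o ^+ 2 * (nk * n * n) ^+ 2 * e ^+ 2)); last by ring.
  by apply: le_trans E' _; rewrite le_eqVlt; apply/orP; left; apply/eqP; ring.
have -> : foam_const (pi / s) (n%:R / 2) n * (expR (n%:R / 2) * (2 ^+ n / om n)) * v =
   (4 * pi / s) ^+ n * Kn * v.
  rewrite foam_constE /Kn.
  have -> : 4 * pi / s = 2 * (2 * pi / s) by ring.
  rewrite [(2 * _) ^+ n]exprMn; move: ((2 * pi / s) ^+ n) (2 ^+ n) => r1 r2; ring.
apply: (@le_lt_trans _ _ ((4 * pi / s) ^+ n * T ^+ n * v)).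
  by rewrite ler_wpM2r // ler_wpM2l // exprn_ge0 // divr_ge0 ?mulr_ge0 ?pi_ge0 ?ltW.
have -> : v = (v `^ n%:R^-1) ^+ n.
  by rewrite -powR_mulrn ?powR_ge0 // -powRrM mulVf ?gt_eqF // powRr1.
rewrite -!exprMn exprn_ilt1 // ?lt0n_neq0 //.
  by rewrite !mulr_ge0 ?powR_ge0 ?pi_ge0 ?invr_ge0 // ltW.
rewrite [ltLHS](_ : _ = 2 * (2 * pi * T * v `^ n%:R^-1) / s); last by ring.
by rewrite ltr_pdivrMr // mul1r -WT; move: hs; lra.
Qed.
End Constants.

(** For negative [v] a cover within [- v / 2] of it would have a negative total. *)
Lemma hausdorff_measure_ge0 (R : realType) (n N : nat) (M : set 'rV[R]_N) (v : R) :
  compact M -> hausdorff_measure n M = v%:E -> 0 <= v.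
Proof.
move=> cM hv; rewrite leNgt; apply/negP => v0.
have e0 : 0 < - v / 2 by rewrite divr_gt0 // oppr_gt0.
have [K [S [d [d0 _ _]]]] := hausdorff_cover cM hv ltr01 e0.
apply/negP; rewrite -ltNge; apply: (@lt_le_trans _ _ 0); first by lra.
apply: sumr_ge0 => i _; rewrite mulr_ge0 ?(ltW (unit_ball_vol_gt0 R n)) // exprn_ge0 //.
by rewrite divr_ge0 // ltW //; case/andP: (d0 i).
Qed.

Theorem theorem1p1 (R : realType) :
  exists C : nat -> R,
    [/\ (forall n, (0 < n)%N -> 0 < C n),
        (exists B : R, forall n, (0 < n)%N -> C n <= B),
        C n @[n --> \oo] --> 2 * pi / Num.sqrt (expR 1) &
        forall (n N : nat) (M : set 'rV[R]_N),
          (0 < n)%N -> (n < N)%N -> closed_submanifold n M ->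
          forall v : R, hausdorff_measure n M = v%:E ->
          (linf_width n M <= (C n * Num.sqrt n%:R * v `^ (n%:R)^-1)%:E)%E].
Proof.
exists (@width_const R); split.
- by move=> n _; exact: width_const_gt0.
- exact: width_const_bounded.
- exact: width_const_cvg.
move=> n N M n0 _ hM v hv; have v0 := hausdorff_measure_ge0 hM.1 hv.
(* The criterion of [width_const_spec] is strict, so the bound is proved with an arbitrary [e > 0]
   added, using cubes of side [2 * (w + e)]. *)
apply/lee_addgt0Pr => e e0; rewrite -EFinD.
set w := width_const R n * _ * _.
have w0 : 0 <= w.
  by rewrite mulr_ge0 ?powR_ge0 // mulr_ge0 ?sqrtr_ge0 // ltW // width_const_gt0.
have s0 : 0 < 2 * (w + e) by rewrite mulr_gt0 // ltr_wpDl.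
have sE : 2 * (w + e) / 2 = w + e by field.
rewrite -sE; apply: (linf_width_le n0 hM hv s0 (lam := n%:R / 2)) => //.
  by rewrite divr_gt0 // ltr0n.
by apply: width_const_spec => //; rewrite sE -/w ltrDl.
Qed.
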